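(* Let $(X,\mu)$ and $(Y,\nu)$ be standard measure spaces and $E\subseteq X\times Y$ a set of finite width. The following conditions are equivalent: (i) $E$ is an operator $U$-set; (ii) $E$ does not support a non-zero Hilbert–Schmidt operator; (iii) $(\mu\times\nu)(E)=0$; (iv) $E$ does not support a non-zero nuclear operator; (v) $E$ does not contain a rectangle of non-zero measure.
   Context: Standard measure space: a ($\sigma$-finite) regular Borel measure with respect to some complete (separable) metrisable topology. $E\subseteq X\times Y$ is a set of finite width if there are $n\in\mathbb N$ and measurable functions $f_i:X\to\mathbb R$, $g_i:Y\to\mathbb R$, $i=1,\dots,n$, with $E=\{(x,y):f_i(x)\le g_i(y),\ i=1,\dots,n\}$. A rectangle is a set $\alpha\times\beta$ with $\alpha\subseteq X$, $\beta\subseteq Y$ measurable. A set is marginally null if contained in $(X_0\times Y)\cup(X\times Y_0)$ with $\mu(X_0)=\nu(Y_0)=0$. $E$ supports an operator $T\in\mathcal B(L^2(X,\mu),L^2(Y,\nu))$ if $P(\beta)TP(\alpha)=0$ whenever $(\alpha\times\beta)\cap E$ is marginally null, where $P(\cdot)$ denotes multiplication by the characteristic function. $E$ is an operator $U$-set if it supports no non-zero compact operator. *)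

(* Defs.v *)
From HB Require Import structures.
From mathcomp Require Import all_boot all_order all_algebra.
From mathcomp Require Import all_classical all_reals all_analysis.
From mathcomp Require Import measurable_realfun complex.

Set Implicit Arguments.
Unset Strict Implicit.
Unset Printing Implicit Defensive.
Import Order.TTheory GRing.Theory Num.Theory.
Import numFieldNormedType.Exports.
Import ComplexField.

Local Open Scope classical_set_scope.
Local Open Scope complex_scope.
Local Open Scope ring_scope.

Section StandardMeasureSpace.
Context d (X : measurableType d) (R : realType).

(* The complete separable metrisable topology on [X] is presented by a complete
   separable metric space [M] together with a bijection [phi : X -> M], along
   which the topology is pulled back.  Regular means that every Borel set is
   outer regular (by open sets) and inner regular (by compact sets). *)
Definition standard_measure (mu : {sigma_finite_measure set X -> \bar R}) : Prop :=
  exists (M : metricType R) (phi : X -> M),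
  [/\ bijective phi,
      forall F : set_system M, ProperFilter F -> cauchy F -> exists l : M, F --> l,
      exists2 D : set M, countable D & dense D,
      forall A : set X, measurable A <->
        exists2 B : set M, <<s [set U : set M | open U] >> B & A = phi @^-1` B &
      forall A : set X, measurable A ->
        mu A = ereal_inf
          [set mu (phi @^-1` U) | U in [set U : set M | open U /\ A `<=` phi @^-1` U]]
        /\
        mu A = ereal_sup
          [set mu (phi @^-1` K) | K in [set K : set M | compact K /\ phi @^-1` K `<=` A]]].

End StandardMeasureSpace.

Section SquareIntegrable.
Context d (X : measurableType d) (R : realType).
Variable mu : {measure set X -> \bar R}.

Local Notation C := (R[i]^o).
Local Notation normc := (@Normc.normc R).
Local Notation N2 f := ('N[mu]_2%:E [EFin \o (normc \o f)])%E.

Definition complex_measurable (f : X -> C) : Prop :=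
  measurable_fun [set: X] (fun x => complex.Re (f x)) /\
  measurable_fun [set: X] (fun x => complex.Im (f x)).

Definition sq_integrable (f : X -> C) : Prop :=
  complex_measurable f /\ finite_norm mu 2%:E (fun x => normc (f x)).

Definition L2pred : {pred X -> C} := [pred f | `[< sq_integrable f >]].

Lemma measurable_normc (f : X -> C) :
  complex_measurable f -> measurable_fun [set: X] (fun x => normc (f x)).
Proof.
move=> [mr mi].
rewrite (_ : (fun _ => _) = (fun x => powR (complex.Re (f x) ^+ 2 +
   complex.Im (f x) ^+ 2) 2^-1)).
  apply: (@measurableT_comp _ _ _ _ _ _ (@powR R ^~ 2^-1)) => //.
  by apply: measurable_funD; exact: measurable_funX.
apply/funext => x; rewrite powR12_sqrt ?addr_ge0 ?sqr_ge0//.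
by case: (f x).
Qed.

Lemma complex_measurableD (f g : X -> C) :
  complex_measurable f -> complex_measurable g -> complex_measurable (f + g).
Proof.
move=> [fr fi] [gr gi]; split.
- rewrite (_ : (fun _ => _) = (fun x => complex.Re (f x) + complex.Re (g x))).
    exact: measurable_funD.
  by apply/funext => x; rewrite /GRing.add/=; case: (f x); case: (g x).
- rewrite (_ : (fun _ => _) = (fun x => complex.Im (f x) + complex.Im (g x))).
    exact: measurable_funD.
  by apply/funext => x; rewrite /GRing.add/=; case: (f x); case: (g x).
Qed.

Lemma complex_measurableM (f g : X -> C) :
  complex_measurable f -> complex_measurable g ->
  complex_measurable (fun x => (f x : R[i]) * g x).
Proof.
move=> [fr fi] [gr gi]; split.
- rewrite (_ : (fun _ => _) = (fun x => complex.Re (f x) * complex.Re (g x) -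
      complex.Im (f x) * complex.Im (g x))).
    by apply: measurable_funB; exact: measurable_funM.
  by apply/funext => x; case: (f x); case: (g x).
- rewrite (_ : (fun _ => _) = (fun x => complex.Re (f x) * complex.Im (g x) +
      complex.Im (f x) * complex.Re (g x))).
    by apply: measurable_funD; exact: measurable_funM.
  by apply/funext => x; case: (f x); case: (g x).
Qed.

Lemma complex_measurable_cst (a : C) : complex_measurable (fun=> a).
Proof. by split; exact: measurable_cst. Qed.

Lemma L2norm_le (f g : X -> R) :
  measurable_fun [set: X] f -> measurable_fun [set: X] g ->
  (forall x, `|f x| <= `|g x|) ->
  ('N[mu]_2%:E[EFin \o f] <= 'N[mu]_2%:E[EFin \o g])%E.
Proof.
move=> mf mg fg; rewrite unlock /Lnorm.
apply: gt0_ler_poweR => //.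
- by rewrite in_itv/= leey andbT integral_ge0// => x _; exact: poweR_ge0.
- by rewrite in_itv/= leey andbT integral_ge0// => x _; exact: poweR_ge0.
- apply: ge0_le_integral => //.
  + by move=> x _; exact: poweR_ge0.
  + apply/measurable_EFinP; apply: (@measurableT_comp _ _ _ _ _ _ (@powR R ^~ 2)) => //.
    exact: measurableT_comp.
  + apply/measurable_EFinP; apply: (@measurableT_comp _ _ _ _ _ _ (@powR R ^~ 2)) => //.
    exact: measurableT_comp.
  + by move=> x _ /=; rewrite lee_fin ge0_ler_powR ?nnegrE.
Qed.

Lemma L2norm_D (f g : X -> C) : complex_measurable f -> complex_measurable g ->
  (N2 (f + g)%R <= N2 f + N2 g)%E.
Proof.
move=> mf mg; have mfg := complex_measurableD mf mg.
have := minkowski_EFin mu (measurable_normc mf) (measurable_normc mg) (ler1n R 2).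
apply: le_trans; apply: L2norm_le.
- exact: measurable_normc.
- by apply: measurable_funD; exact: measurable_normc.
- move=> x /=; rewrite !ger0_norm ?addr_ge0//.
  + exact: le_normcD.
  all: by rewrite /Normc.normc; case: (_ x) => ? ?; exact: sqrtr_ge0.
Qed.

Lemma normc_ge0 (z : R[i]) : 0 <= normc z.
Proof. by case: z => a b; exact: sqrtr_ge0. Qed.

Lemma L2norm_scale (a : C) (f : X -> C) : complex_measurable f ->
  (N2 (fun x => (a : R[i]) * f x)%R = (normc a)%:E * N2 f)%E.
Proof.
move=> mf.
have [->|a0] := eqVneq (a : R[i]) 0.
  rewrite Normc.normc0 mul0e -[RHS](@Lnorm0 _ _ _ mu 2%:E) ?eqe ?pnatr_eq0//.
  by apply: eq_Lnorm => x /=; rewrite mul0r Normc.normc0.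
rewrite unlock /Lnorm.
under eq_integral.
  move=> x _ /=; rewrite Normc.normcM normrM (ger0_norm (normc_ge0 a)).
  rewrite powRM ?normc_ge0// EFinM; over.
rewrite ge0_integralZl_EFin ?powR_ge0//; last first.
  apply/measurable_EFinP.
  apply: (@measurableT_comp _ _ _ _ _ _ (@powR R ^~ 2)) => //.
  by apply: measurableT_comp => //; exact: measurable_normc.
rewrite poweRM ?lee_fin ?powR_ge0 ?integral_ge0//.
by rewrite poweR_EFin -powRrM mulfV// powRr1// normc_ge0.
Qed.

Lemma sq_integrable0 : sq_integrable 0.
Proof.
split; first exact: complex_measurable_cst.
rewrite /finite_norm (_ : _ \o _ = cst 0%E).
  by rewrite Lnorm0// eqe pnatr_eq0.
by apply/funext => x; congr EFin; exact: Normc.normc0.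
Qed.

Lemma L2pred_submod_closed : submod_closed L2pred.
Proof.
split; first by apply/asboolP; exact: sq_integrable0.
move=> a f g /asboolP[mf lf] /asboolP[mg lg]; apply/asboolP.
have maf : complex_measurable (a *: f).
  exact: (complex_measurableM (complex_measurable_cst a) mf).
split; first exact: complex_measurableD.
apply: (le_lt_trans (L2norm_D maf mg)).
by rewrite lte_add_pinfty// (L2norm_scale a mf) lte_mul_pinfty ?lee_fin ?normc_ge0.
Qed.

HB.instance Definition _ :=
  GRing.isSubmodClosed.Build R[i] (X -> C) L2pred L2pred_submod_closed.

Record L2fun := MkL2fun { L2val :> X -> C; _ : L2val \in L2pred }.

HB.instance Definition _ := [isSub for L2val].
HB.instance Definition _ := [Choice of L2fun by <:].
HB.instance Definition _ := [SubChoice_isSubLmodule of L2fun by <:].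

Lemma L2funP (f : L2fun) : sq_integrable f.
Proof. by case: f => f /= /asboolP. Qed.

Definition L2null : {pred L2fun} :=
  [pred f : L2fun | `[< {ae mu, forall x, f x = 0} >]].

Lemma L2null_zmod_closed : zmod_closed L2null.
Proof.
split; first by apply/asboolP; exact: aeW.
move=> f g /asboolP f0 /asboolP g0; apply/asboolP.
by apply: filterS2 f0 g0 => x /= fx gx; rewrite [LHS](_ : _ = f x - g x)// fx gx subrr.
Qed.

HB.instance Definition _ := GRing.isZmodClosed.Build L2fun L2null L2null_zmod_closed.

End SquareIntegrable.

Section L2.
Context d (X : measurableType d) (R : realType).
Variable mu : {measure set X -> \bar R}.
Local Notation normc := (@Normc.normc R).
Local Open Scope quotient_scope.

(* L^2(X, mu) over the complex numbers R[i] : square integrable functions modulo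
   almost everywhere equality. *)
Definition L2 : Type := Quotient.quot (@L2null d X R mu).

HB.instance Definition _ := Choice.on L2.
HB.instance Definition _ := GRing.Zmodule.on L2.
HB.instance Definition _ := EqQuotient.on L2.

Definition L2pi (f : L2fun mu) : L2 := \pi_L2 f.

Definition L2repr (f : L2) : L2fun mu := repr f.

Lemma L2reprK (f : L2) : L2pi (L2repr f) = f.
Proof. exact: reprK. Qed.

Lemma L2piP (f g : L2fun mu) : L2pi f = L2pi g <-> {ae mu, forall x, f x = g x}.
Proof.
split.
  move/eqP; rewrite -Quotient.idealrBE => /asboolP; apply: filterS => x.
  by rewrite [LHS](_ : _ = f x - g x)// => /eqP; rewrite subr_eq0 => /eqP.
move=> fg; apply/eqP; rewrite -Quotient.idealrBE; apply/asboolP.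
by apply: filterS fg => x fgx; rewrite [LHS](_ : _ = f x - g x)// fgx subrr.
Qed.

Lemma L2piK (f : L2fun mu) : {ae mu, forall x, L2repr (L2pi f) x = f x}.
Proof. by apply/L2piP; exact: L2reprK. Qed.

Lemma L2W (P : L2 -> Prop) : (forall f, P (L2pi f)) -> forall f, P f.
Proof. by move=> Pf f; rewrite -[f]L2reprK. Qed.

(* The class of a function; 0 (junk value) if it is not square integrable. *)
Definition L2class (f : X -> R[i]^o) : L2 := L2pi (insubd (0 : L2fun mu) f).

Definition L2scale (a : R[i]) (f : L2) : L2 := L2pi (a *: L2repr f).

Lemma L2pi_scale a (f : L2fun mu) : L2scale a (L2pi f) = L2pi (a *: f).
Proof.
apply/L2piP; apply: filterS (L2piK f) => x fx.
by rewrite [LHS](_ : _ = a *: L2repr (L2pi f) x)// fx.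
Qed.

Lemma L2pi_add (f g : L2fun mu) : L2pi (f + g) = L2pi f + L2pi g.
Proof. exact: Quotient.pi_add. Qed.

Lemma L2pi0 : L2pi 0 = 0.
Proof. by rewrite /L2pi !piE. Qed.

Lemma L2scaleA a b f : L2scale a (L2scale b f) = L2scale (a * b) f.
Proof. by elim/L2W: f => f; rewrite !L2pi_scale scalerA. Qed.

Lemma L2scale1 : left_id 1 L2scale.
Proof. by elim/L2W => f; rewrite L2pi_scale scale1r. Qed.

Lemma L2scaleDr : right_distributive L2scale +%R.
Proof.
move=> a; elim/L2W => f; elim/L2W => g.
by rewrite -L2pi_add !L2pi_scale scalerDr L2pi_add.
Qed.

Lemma L2scaleDl f : {morph L2scale^~ f : a b / a + b}.
Proof. by move=> a b; elim/L2W: f => f; rewrite !L2pi_scale scalerDl L2pi_add. Qed.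

HB.instance Definition _ :=
  GRing.Zmodule_isLmodule.Build R[i] L2 L2scaleA L2scale1 L2scaleDr L2scaleDl.

Definition L2norm (f : L2) : R :=
  fine 'N[mu]_2%:E[EFin \o (normc \o L2repr f)]%E.

Lemma L2norm_EFin (f : L2) :
  (L2norm f)%:E = 'N[mu]_2%:E[EFin \o (normc \o L2repr f)]%E.
Proof.
rewrite /L2norm fineK// ge0_fin_numE ?Lnorm_ge0//.
by have [_] := L2funP (L2repr f).
Qed.

Lemma L2norm_pi (f : L2fun mu) :
  (L2norm (L2pi f))%:E = 'N[mu]_2%:E[EFin \o (normc \o f)]%E.
Proof.
have mN (g : L2fun mu) :
    measurable_fun [set: X] (fun x => (`|(normc (g x))%:E| `^ 2)%E).
  apply/measurable_EFinP; apply: (@measurableT_comp _ _ _ _ _ _ (@powR R ^~ 2)) => //.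
  by apply: measurableT_comp => //; apply: measurable_normc; have [] := L2funP g.
rewrite L2norm_EFin unlock /Lnorm; congr (_ `^ _)%E.
apply: ge0_ae_eq_integral => //; [exact: mN|exact: mN|..].
- by move=> x _; exact: poweR_ge0.
- by move=> x _; exact: poweR_ge0.
- by apply: filterS (L2piK f) => x /= ->.
Qed.

Definition L2normC (f : L2) : R[i] := (L2norm f)%:C.

Lemma L2normD (f g : L2) : L2normC (f + g) <= L2normC f + L2normC g.
Proof.
rewrite /L2normC -rmorphD lecR/= -lee_fin EFinD.
elim/L2W: f => f; elim/L2W: g => g; rewrite -L2pi_add !L2norm_pi.
by apply: L2norm_D; [have [] := L2funP f|have [] := L2funP g].
Qed.

Lemma L2normZ (a : R[i]) (f : L2) : L2normC (a *: f) = `|a| * L2normC f.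
Proof.
rewrite [`|a|](_ : _ = (normc a)%:C)// /L2normC -rmorphM; congr (_%:C).
apply: EFin_inj; rewrite EFinM.
elim/L2W: f => f; rewrite [_ *: _]L2pi_scale !L2norm_pi.
by apply: L2norm_scale; have [] := L2funP f.
Qed.

Lemma L2norm_eq0 (f : L2) : L2normC f = 0 -> f = 0.
Proof.
elim/L2W: f => f N0.
have f0 : 'N[mu]_2%:E[EFin \o (normc \o f)]%E = 0%E.
  by rewrite -L2norm_pi; congr EFin; exact: (congr1 (@complex.Re R) N0).
have [mf _] := L2funP f.
rewrite -L2pi0; apply/L2piP.
have mE : measurable_fun [set: X] (EFin \o (normc \o f)).
  exact/measurable_EFinP/measurable_normc.
have p0 : (0 < 2%:E :> \bar R)%E by rewrite lte_fin.
have := Lnorm_eq0_eq0 mE p0 f0.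
by apply: filterS => x /(_ I) [] /Normc.eq0_normc.
Qed.

HB.instance Definition _ :=
  @Lmodule_isNormed.Build R[i] L2 L2normC L2normD L2normZ L2norm_eq0.

Lemma L2normE (f : L2) : `|f| = (L2norm f)%:C.
Proof. by []. Qed.

(* Linear in the first argument. *)
Definition L2dot (f g : L2) : R[i] :=
  let h x := (L2repr f x : R[i]) * (L2repr g x)^* in
  Rintegral mu [set: X] (fun x => complex.Re (h x)) +i*
  Rintegral mu [set: X] (fun x => complex.Im (h x)).

Definition charmul (A : set X) (f : L2) : L2 :=
  L2class (fun x => (\1_A x : R)%:C * L2repr f x).

Lemma charmulE (A : set X) (f : L2) : measurable A ->
  {ae mu, forall x, L2repr (charmul A f) x = (\1_A x : R)%:C * L2repr f x}.
Proof.
move=> mA; have [mf lf] := L2funP (L2repr f).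
have mh : complex_measurable (fun x => (\1_A x : R)%:C * L2repr f x : R[i]^o).
  apply: (@complex_measurableM _ _ _ (fun x => (\1_A x : R)%:C) (L2repr f)) => //.
  by split => /=; [exact: measurable_indic|exact: measurable_cst].
have hP : (fun x => (\1_A x : R)%:C * L2repr f x : R[i]^o) \in L2pred mu.
  apply/asboolP; split => //; apply: le_lt_trans lf.
  apply: L2norm_le; [exact: measurable_normc|exact: measurable_normc|].
  move=> x; rewrite Normc.normcM normrM ler_piMl// ger0_norm ?normc_ge0//.
  by rewrite indicE; case: (x \in A); rewrite ?Normc.normc1 ?Normc.normc0.
have hE := insubdK (0 : L2fun mu) hP.
pose h x : R[i]^o := (\1_A x : R)%:C * L2repr f x.
apply: filterS (L2piK (insubd (0 : L2fun mu) h)) => x ->.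
exact: (congr1 (fun f => f x) hE).
Qed.

End L2.

Section NormedOperators.
Context (K : numFieldType) (V W : normedModType K).

Definition bounded_operator (T : V -> W) : Prop :=
  exists M : K, forall x, `|T x| <= M * `|x|.

Definition compact_operator (T : V -> W) : Prop :=
  precompact (T @` [set x : V | `|x| <= 1]).

Definition lin_span (B : set V) : set V :=
  [set v | exists (n : nat) (c : 'I_n -> K) (e : 'I_n -> V),
     (forall i, B (e i)) /\ v = \sum_(i < n) c i *: e i].

End NormedOperators.

Section L2Operators.
Context d1 (X : measurableType d1) d2 (Y : measurableType d2) (R : realType).
Variables (mu : {measure set X -> \bar R}) (nu : {measure set Y -> \bar R}).

Definition orthonormal_basis (B : set (L2 mu)) : Prop :=
  (forall e f, B e -> B f -> L2dot e f = (e == f)%:R) /\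
  closure (lin_span B) = [set: L2 mu].

Definition Hilbert_Schmidt (T : L2 mu -> L2 nu) : Prop :=
  exists2 B : set (L2 mu), orthonormal_basis B &
    (\esum_(e in B) (L2norm (T e) ^+ 2)%:E < +oo)%E.

(* [T f = sum_n <f, u_n> v_n], where the sum of [|u_n| |v_n|] is finite. *)
Definition nuclear (T : L2 mu -> L2 nu) : Prop :=
  exists (u : nat -> L2 mu) (v : nat -> L2 nu),
    (\sum_(0 <= n <oo) (L2norm (u n) * L2norm (v n))%:E < +oo)%E /\
    forall f, series (fun n => L2dot f (u n) *: v n) @ \oo --> T f.

Definition marginally_null (S : set (X * Y)) : Prop :=
  exists (X0 : set X) (Y0 : set Y),
    [/\ measurable X0, mu X0 = 0%E, measurable Y0, nu Y0 = 0%E &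
        S `<=` (X0 `*` [set: Y]) `|` ([set: X] `*` Y0)].

Definition supports (E : set (X * Y)) (T : L2 mu -> L2 nu) : Prop :=
  forall (alpha : set X) (beta : set Y), measurable alpha -> measurable beta ->
    marginally_null ((alpha `*` beta) `&` E) ->
    forall f, charmul beta (T (charmul alpha f)) = 0.

Definition supports_nonzero (P : (L2 mu -> L2 nu) -> Prop) (E : set (X * Y)) : Prop :=
  exists T : {linear L2 mu -> L2 nu},
    [/\ bounded_operator T, supports E T, P T & exists f, T f != 0].

Definition operator_U_set (E : set (X * Y)) : Prop :=
  ~ supports_nonzero (@compact_operator _ _ _) E.

Definition finite_width (E : set (X * Y)) : Prop :=
  exists (n : nat) (f : 'I_n -> X -> R) (g : 'I_n -> Y -> R),
    [/\ forall i, measurable_fun [set: X] (f i),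
        forall i, measurable_fun [set: Y] (g i) &
        E = [set z | forall i, f i z.1 <= g i z.2]].

End L2Operators.

(* Main.v *)
Require Import Defs.
From HB Require Import structures.
From mathcomp Require Import all_boot all_order all_algebra.
From mathcomp Require Import all_classical all_reals all_analysis.
From mathcomp Require Import measurable_realfun complex ring lra.
From mathcomp Require finmap.

Set Implicit Arguments.
Unset Strict Implicit.
Unset Printing Implicit Defensive.
Import Order.TTheory GRing.Theory Num.Theory.
Import numFieldNormedType.Exports.
Import ComplexField.

Local Open Scope classical_set_scope.
Local Open Scope complex_scope.
Local Open Scope ring_scope.

(* Every one of (i)-(iv) is shown equivalent to (v).

   A rectangle [alpha x beta] of positive measure inside [E] carries the rank
   one operator [<., 1_alpha'> 1_beta'] with [alpha'], [beta'] of finite positive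
   measure; it is compact, nuclear and Hilbert-Schmidt (the latter requires an
   orthonormal basis of [L2], hence completeness).

   Conversely let [E = {f_i(x) <= g_i(y), i < n}] contain no such rectangle, and
   let [T] be compact and supported on [E].  By induction on [n], [T] vanishes:
   the rectangle [{f_n <= c} x {c <= g_n}] reduces to the first [n] inequalities,
   so the block of [T] over it is zero by induction, while the block over
   [{f_n > c} x {g_n <= c}] is zero because [T] is supported on [E].  Hence [T]
   intertwines the spectral projections of [f_n] and [g_n], and has zero range
   over each level set of [g_n].  Bisecting repeatedly a vector [v] with
   [T v <> 0] gives unit vectors whose images have norms bounded below and live
   on sets shrinking to a level set of [g_n]; this is impossible for compact [T].
   Hilbert-Schmidt and nuclear operators, being norm limits of finite rank
   operators, are handled in the same way.
   The same induction, with [c] ranging over the rationals and the countably many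
   atoms of [g_n], shows that [E] is null. *)

(** * Representatives and the real-valued norm of [L2] *)

Section L2Basics.
Context d (X : measurableType d) (R : realType).
Variable mu : {measure set X -> \bar R}.
Local Notation normc := (@Normc.normc R).

Lemma sqr_normcE (z : R[i]) : normc z ^+ 2 = complex.Re z ^+ 2 + complex.Im z ^+ 2.
Proof. by case: z => a b /=; rewrite sqr_sqrtr// addr_ge0// sqr_ge0. Qed.

Lemma L2repr_measurable (f : L2 mu) : complex_measurable (L2repr f).
Proof. by have [] := L2funP (L2repr f). Qed.

Lemma L2norm_ge0 (f : L2 mu) : 0 <= L2norm f.
Proof. by rewrite -lee_fin L2norm_EFin Lnorm_ge0. Qed.

Lemma sq_integral_norm (h : X -> R[i]) :
  (('N[mu]_2%:E[EFin \o (normc \o h)]) `^ 2 = \int[mu]_x (normc (h x) ^+ 2)%:E)%E.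
Proof.
rewrite poweR_Lnorm// ?pnatr_eq0//; apply: eq_integral => x _ /=.
by rewrite ger0_norm ?normc_ge0// -powR_mulrn ?normc_ge0.
Qed.

Lemma L2norm_sqr (f : L2 mu) :
  ((L2norm f ^+ 2)%:E = \int[mu]_x (normc (L2repr f x) ^+ 2)%:E)%E.
Proof.
by rewrite -sq_integral_norm -L2norm_EFin poweR_EFin -powR_mulrn// L2norm_ge0.
Qed.

Lemma sqr_normc_measurable (h : X -> R[i]^o) : complex_measurable h ->
  measurable_fun [set: X] (fun x => normc (h x) ^+ 2).
Proof. by move=> mh; apply: measurable_funX; exact: measurable_normc. Qed.

Lemma sqr_normc_integrable (f : L2 mu) :
  mu.-integrable [set: X] (fun x => (normc (L2repr f x) ^+ 2)%:E).
Proof.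
apply/integrableP; split.
  by apply/measurable_EFinP; exact/sqr_normc_measurable/L2repr_measurable.
under eq_integral => x _ do rewrite abse_EFin ger0_norm ?sqr_ge0//.
by rewrite -L2norm_sqr ltry.
Qed.

Lemma sq_integrableP (h : X -> R[i]^o) : complex_measurable h ->
  (\int[mu]_x (normc (h x) ^+ 2)%:E < +oo)%E -> sq_integrable mu h.
Proof.
move=> mh; rewrite -sq_integral_norm => lth; split => //.
rewrite /finite_norm /=.
move: lth; move: ('N[_]_ _ [_])%E => -[r _| |]//; first by rewrite ltry.
by rewrite poweRyr// pnatr_eq0.
Qed.

Lemma L2classE (h : X -> R[i]^o) : sq_integrable mu h ->
  {ae mu, forall x, L2repr (L2class mu h) x = h x}.
Proof.
move=> /asboolP hP; have hE := insubdK (0 : L2fun mu) hP.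
apply: filterS (L2piK (insubd (0 : L2fun mu) h)) => x ->.
exact: (congr1 (fun f => f x) hE).
Qed.

Lemma L2eqP (f g : L2 mu) : f = g <-> {ae mu, forall x, L2repr f x = L2repr g x}.
Proof.
split=> [->|fg]; first exact: aeW.
by rewrite -[f]L2reprK -[g]L2reprK; apply/L2piP.
Qed.

Lemma L2reprD (f g : L2 mu) :
  {ae mu, forall x, L2repr (f + g) x = (L2repr f x : R[i]) + L2repr g x}.
Proof.
have := L2piK (L2repr f + L2repr g); rewrite L2pi_add !L2reprK.
by apply: filterS => x ->.
Qed.

Lemma L2reprZ (a : R[i]) (f : L2 mu) :
  {ae mu, forall x, L2repr (a *: f) x = a * (L2repr f x : R[i])}.
Proof. by have := L2piK (a *: L2repr f); apply: filterS => x ->. Qed.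

Lemma L2repr0 : {ae mu, forall x, L2repr (0 : L2 mu) x = 0 :> R[i]}.
Proof. by have := L2piK (0 : L2fun mu); rewrite L2pi0; apply: filterS => x ->. Qed.

Lemma L2norm_triangle (f g : L2 mu) : L2norm (f + g) <= L2norm f + L2norm g.
Proof. by have := ler_normD f g; rewrite !L2normE -rmorphD lecR. Qed.

Lemma L2normZr (a : R[i]) (f : L2 mu) : L2norm (a *: f) = normc a * L2norm f.
Proof.
by have := normrZ a f; rewrite !L2normE [ `|a|](_ : _ = (normc a)%:C)// -rmorphM => -[].
Qed.

Lemma L2norm0 : L2norm (0 : L2 mu) = 0.
Proof. by have := @normr0 _ (L2 mu); rewrite L2normE => -[]. Qed.

Lemma L2norm_eq0P (f : L2 mu) : L2norm f = 0 -> f = 0.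
Proof. by move=> f0; apply/eqP; rewrite -normr_eq0 L2normE f0. Qed.

Lemma L2normN (f : L2 mu) : L2norm (- f) = L2norm f.
Proof. by have := normrN f; rewrite !L2normE => -[]. Qed.

Lemma L2norm_distC (f g : L2 mu) : L2norm (f - g) = L2norm (g - f).
Proof. by rewrite -L2normN opprB. Qed.

Lemma ball_L2norm (f g : L2 mu) (e : R) : ball f e%:C g <-> L2norm (f - g) < e.
Proof. by rewrite -ball_normE /= L2normE ltcR. Qed.

(** The norm takes values in [R[i]], where [0 < e] forces [e] to be real; balls of complex radius
    thus reduce to balls of real radius. *)
Lemma closure_L2normP (S : set (L2 mu)) f :
  closure S f <-> forall e : R, 0 < e -> exists2 g, S g & L2norm (f - g) < e.
Proof.
split=> [Sf e e0|Sf B /nbhs_ballP[e /= e0 fB]].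
  have e0' : (0 : R[i]) < e%:C by rewrite ltcR.
  by have [g [Sg /ball_L2norm]] := Sf _ (nbhsx_ballx f e%:C e0'); exists g.
have eE : e = (complex.Re e)%:C.
  by move: e0; case: e {fB} => a b; rewrite ltcE /= => /andP[/eqP -> _].
have [|g Sg /ball_L2norm fg] := Sf (complex.Re e).
  by rewrite -ltcR -eE.
by exists g; split => //; apply: fB; rewrite eE.
Qed.

End L2Basics.

(** * Multiplication by characteristic functions *)

Section Charmul.
Context d (X : measurableType d) (R : realType).
Variable mu : {measure set X -> \bar R}.
Local Notation normc := (@Normc.normc R).
Implicit Types (A B : set X) (f g : L2 mu).

Lemma charmulD A f g : measurable A -> charmul A (f + g) = charmul A f + charmul A g.
Proof.
move=> mA; apply/L2eqP.
apply: filterS3 (filterI (charmulE f mA) (charmulE g mA)) (charmulE (f + g) mA)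
  (filterI (L2reprD f g) (L2reprD (charmul A f) (charmul A g))).
by move=> x [fE gE] -> [-> ->]; rewrite fE gE mulrDr.
Qed.

Lemma charmulZ A (a : R[i]) f : measurable A -> charmul A (a *: f) = a *: charmul A f.
Proof.
move=> mA; apply/L2eqP.
apply: filterS3 (charmulE f mA) (charmulE (a *: f) mA)
  (filterI (L2reprZ a f) (L2reprZ a (charmul A f))).
by move=> x fE -> [-> ->]; rewrite fE mulrCA.
Qed.

Lemma charmul_linear A : measurable A -> linear (@charmul _ X R mu A).
Proof. by move=> mA a f g; rewrite charmulD// charmulZ. Qed.

Lemma charmul0 A : measurable A -> charmul A (0 : L2 mu) = 0.
Proof. by move=> mA; rewrite -(scale0r (0 : L2 mu)) charmulZ// !scale0r. Qed.

Lemma charmulN A f : measurable A -> charmul A (- f) = - charmul A f.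
Proof. by move=> mA; rewrite -scaleN1r charmulZ// scaleN1r. Qed.

Lemma charmulB A f g : measurable A -> charmul A (f - g) = charmul A f - charmul A g.
Proof. by move=> mA; rewrite charmulD// charmulN. Qed.

Lemma charmulI A B f : measurable A -> measurable B ->
  charmul A (charmul B f) = charmul (A `&` B) f.
Proof.
move=> mA mB; have mAB := measurableI _ _ mA mB; apply/L2eqP.
apply: filterS3 (charmulE f mB) (charmulE (charmul B f) mA) (charmulE f mAB).
move=> x fE -> ->; rewrite fE mulrA; congr (_ * _).
by rewrite -rmorphM !indicE in_setI -natrM mulnb.
Qed.

Lemma charmulT f : charmul [set: X] f = f.
Proof.
apply/L2eqP; apply: filterS (charmulE f measurableT) => x ->.
by rewrite indicT mul1r.
Qed.

Lemma charmulU A B f : measurable A -> measurable B -> [disjoint A & B] ->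
  charmul (A `|` B) f = charmul A f + charmul B f.
Proof.
move=> mA mB /disj_set2P AB; have mAB := measurableU _ _ mA mB; apply/L2eqP.
apply: filterS3 (filterI (charmulE f mA) (charmulE f mB)) (charmulE f mAB)
  (L2reprD (charmul A f) (charmul B f)).
move=> x [fA fB] -> ->; rewrite fA fB -mulrDl; congr (_ * _).
rewrite -rmorphD !indicE in_setU -natrD; congr ((_%:R)%:C).
have : ~~ ((x \in A) && (x \in B)) by rewrite -in_setI AB in_set0.
by case: (x \in A); case: (x \in B).
Qed.

Lemma charmul_setC A f : measurable A -> f = charmul A f + charmul (~` A) f.
Proof.
move=> mA; rewrite -charmulU ?setUv ?charmulT//; first exact: measurableC.
by apply/disj_set2P; rewrite setICr.
Qed.

Lemma charmul_null A f : measurable A -> mu A = 0%E -> charmul A f = 0.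
Proof.
move=> mA A0; apply/L2eqP.
have nA : {ae mu, forall x, ~ A x}.
  by exists A; split => // x /= /contrapT.
apply: filterS3 nA (charmulE f mA) (L2repr0 mu) => x Ax -> ->.
by rewrite indicE memNset// mul0r.
Qed.

Lemma charmul_set0 f : charmul set0 f = 0.
Proof. by apply: charmul_null; rewrite ?measure0. Qed.

Lemma L2norm_charmul A f : measurable A ->
  ((L2norm (charmul A f) ^+ 2)%:E =
    \int[mu]_(x in A) (normc (L2repr f x) ^+ 2)%:E)%E.
Proof.
move=> mA; rewrite L2norm_sqr [RHS]integral_mkcond; apply: ge0_ae_eq_integral => //.
- by apply/measurable_EFinP; exact/sqr_normc_measurable/L2repr_measurable.
- apply/(measurable_restrictT _ mA); apply: measurable_funTS.
  by apply/measurable_EFinP; exact/sqr_normc_measurable/L2repr_measurable.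
- by move=> x _; rewrite lee_fin sqr_ge0.
- by move=> x _; apply: erestrict_ge0 => y _; rewrite lee_fin sqr_ge0.
- apply: filterS (charmulE f mA) => x /= -> _.
  rewrite patchE indicE; case: (x \in A); first by rewrite mul1r.
  by rewrite mul0r Normc.normc0 expr0n.
Qed.

Lemma charmul_pythagoras A f : measurable A ->
  L2norm f ^+ 2 = L2norm (charmul A f) ^+ 2 + L2norm (charmul (~` A) f) ^+ 2.
Proof.
move=> mA; have mAC := measurableC mA.
apply: EFin_inj; rewrite EFinD !L2norm_charmul// L2norm_sqr -[in LHS](setUv A).
rewrite ge0_integral_setU//; last first.
- by rewrite /disj_set setICr.
- by move=> x _; rewrite lee_fin sqr_ge0.
- rewrite setUv; apply/measurable_EFinP.
  exact/sqr_normc_measurable/L2repr_measurable.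
Qed.

Lemma L2norm_charmul_le A f : measurable A -> L2norm (charmul A f) <= L2norm f.
Proof.
move=> mA; rewrite -(ler_pXn2r (n:=2))// ?nnegrE ?L2norm_ge0//.
by rewrite (charmul_pythagoras f mA) lerDl sqr_ge0.
Qed.

(** Dominated convergence, with dominating function [|f|^2], for the restrictions of [|f|^2] to
    [B n]: at each point they are eventually constant, and the limit has integral zero by
    assumption. *)
Lemma charmul_nonincreasing_cvg (B : nat -> set X) f :
  (forall n, measurable (B n)) -> nonincreasing_seq B ->
  charmul (\bigcap_n B n) f = 0 ->
  forall e : R, 0 < e -> \forall n \near \oo, L2norm (charmul (B n) f) < e.
Proof.
move=> mB niB B0 e e0.
have mBB : measurable (\bigcap_n B n) by apply: bigcap_measurable.
pose h x := (normc (L2repr f x) ^+ 2)%:E.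
have mh : measurable_fun [set: X] h.
  by apply/measurable_EFinP; exact/sqr_normc_measurable/L2repr_measurable.
have h0 x : (0 <= h x)%E by rewrite lee_fin sqr_ge0.
have cvgI : (\int[mu]_x (h \_ (B n)) x @[n --> \oo] -->
    \int[mu]_x (h \_ (\bigcap_n B n)) x)%E.
  have [] // := @dominated_convergence _ _ _ mu setT measurableT
    (fun n => h \_ (B n)) (h \_ (\bigcap_n B n)) h.
  - by move=> n; apply/(measurable_restrictT _ (mB n)); exact: measurable_funTS.
  - by apply/(measurable_restrictT _ mBB); exact: measurable_funTS.
  - apply: aeW => x _; apply: cvg_near_cst.
    have [Bx|] := pselect ((\bigcap_n B n) x).
      by near=> n; rewrite !patchE !mem_set//; exact: Bx.
    move=> /[dup] nBx /existsNP[k] /not_implyP[_ nBk].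
    exists k => // n /= kn; rewrite !patchE !memNset//.
    by move=> Bn; apply: nBk; have /subsetPset := niB _ _ kn; exact.
  - exact: sqr_normc_integrable.
  - apply: aeW => x n _; rewrite patchE; case: ifP => _; last by rewrite abse0.
    by rewrite gee0_abs.
move: cvgI; rewrite -integral_mkcond -L2norm_charmul// B0 L2norm0 expr0n.
under eq_fun do rewrite -integral_mkcond -L2norm_charmul//.
move=> /fine_cvgP[_] /cvgrPdist_lt/(_ (e ^+ 2)) /=.
rewrite exprn_gt0// => /(_ isT); apply: filterS => n.
rewrite sub0r normrN ger0_norm ?sqr_ge0//.
by rewrite ltr_pXn2r// nnegrE ?L2norm_ge0// ltW.
Unshelve. all: by end_near. Qed.

End Charmul.

(** * Complex integrals and the inner product of [L2] *)

Section InnerProduct.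
Context d (X : measurableType d) (R : realType).
Variable mu : {measure set X -> \bar R}.
Local Notation normc := (@Normc.normc R).
Implicit Types (f g h : L2 mu).

Definition cintegrable (k : X -> R[i]^o) :=
  complex_measurable k /\ mu.-integrable [set: X] (fun x => (normc (k x))%:E).

(** Taken componentwise, in the very shape of [L2dot], so that [L2dotE] holds by computation and
    linearity of the integral transfers to the inner product. *)
Definition cintegral (k : X -> R[i]^o) : R[i] :=
  Rintegral mu [set: X] (fun x => complex.Re (k x)) +i*
  Rintegral mu [set: X] (fun x => complex.Im (k x)).

Lemma normr_Re_le_normc (z : R[i]) : `|complex.Re z| <= normc z.
Proof.
by rewrite -(ler_pXn2r (n:=2))// ?nnegrE ?normc_ge0// sqr_normcE real_normK
  ?num_real// lerDl sqr_ge0.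
Qed.

Lemma normr_Im_le_normc (z : R[i]) : `|complex.Im z| <= normc z.
Proof.
by rewrite -(ler_pXn2r (n:=2))// ?nnegrE ?normc_ge0// sqr_normcE real_normK
  ?num_real// lerDr sqr_ge0.
Qed.

Lemma cintegrable_Re k : cintegrable k ->
  mu.-integrable [set: X] (EFin \o (fun x => complex.Re (k x))).
Proof.
move=> [[mr _] ik]; apply: le_integrable ik => //; first exact/measurable_EFinP.
by move=> x _ /=; rewrite lee_fin (ger0_norm (normc_ge0 _)) normr_Re_le_normc.
Qed.

Lemma cintegrable_Im k : cintegrable k ->
  mu.-integrable [set: X] (EFin \o (fun x => complex.Im (k x))).
Proof.
move=> [[_ mi] ik]; apply: le_integrable ik => //; first exact/measurable_EFinP.
by move=> x _ /=; rewrite lee_fin (ger0_norm (normc_ge0 _)) normr_Im_le_normc.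
Qed.

Lemma ae_eq_cintegral (k l : X -> R[i]^o) :
  complex_measurable k -> complex_measurable l ->
  {ae mu, forall x, k x = l x} -> cintegral k = cintegral l.
Proof.
move=> [kr ki] [lr li] kl; congr (_ +i* _); congr fine; apply: ae_eq_integral => //;
  try (exact/measurable_EFinP); by apply: filterS kl => x -> _.
Qed.

Lemma cintegralD k l : cintegrable k -> cintegrable l ->
  cintegral (fun x => (k x : R[i]) + l x) = cintegral k + cintegral l.
Proof.
move=> ik il; rewrite /cintegral.
rewrite -[RHS]/((_ + _) +i* (_ + _)) -!RintegralD//.
- by congr (_ +i* _); apply: eq_Rintegral => x _; case: (k x); case: (l x).
- exact: cintegrable_Im.
- exact: cintegrable_Im.
- exact: cintegrable_Re.
- exact: cintegrable_Re.
Qed.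

Lemma cintegralZ (a : R[i]) k : cintegrable k ->
  cintegral (fun x => a * (k x : R[i])) = a * cintegral k.
Proof.
move=> ik; rewrite /cintegral; case: a => a b.
have iR := cintegrable_Re ik; have iI := cintegrable_Im ik.
have Zi c (u : X -> R) : mu.-integrable [set: X] (EFin \o u) ->
    mu.-integrable [set: X] (EFin \o (fun x => c * u x)).
  by move=> iu; exact: (@integrableZl _ _ _ mu _ measurableT c _ iu).
rewrite -[RHS]/((_ - _) +i* (_ + _)) -!RintegralZl// -RintegralB//; try exact: Zi.
rewrite -RintegralD//; try exact: Zi.
by congr (_ +i* _); apply: eq_Rintegral => x _; case: (k x).
Qed.

Lemma cintegral_conj k : cintegrable k -> cintegral (fun x => (k x : R[i])^*) = (cintegral k)^*.
Proof.
move=> ik; rewrite /cintegral.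
rewrite -[RHS]/(_ +i* (- _)) -mulN1r -RintegralZl//; last exact: cintegrable_Im.
by congr (_ +i* _); apply: eq_Rintegral => x _; case: (k x) => //= a b; rewrite mulN1r.
Qed.

Definition dotfun f g : X -> R[i]^o := fun x => (L2repr f x : R[i]) * (L2repr g x)^*.

Lemma normc_conj (z : R[i]) : normc (z^*) = normc z.
Proof. by case: z => a b /=; rewrite sqrrN. Qed.

Lemma dotfun_measurable f g : complex_measurable (dotfun f g).
Proof.
apply: complex_measurableM; first exact: L2repr_measurable.
have [mr mi] := L2repr_measurable g; split.
  by apply: eq_measurable_fun mr => x _; case: (L2repr g x).
have mN : measurable_fun [set: X] (fun x => - complex.Im (L2repr g x)).
  exact: measurableT_comp.
by apply: eq_measurable_fun mN => x _; case: (L2repr g x).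
Qed.

(** Domination by [|f|^2 + |g|^2], from [ab <= a^2 + b^2]. *)
Lemma dotfun_integrable f g : cintegrable (dotfun f g).
Proof.
split; first exact: dotfun_measurable.
have i2 := integrableD measurableT (sqr_normc_integrable f) (sqr_normc_integrable g).
apply: le_integrable i2 => //.
  by apply/measurable_EFinP; exact/measurable_normc/dotfun_measurable.
move=> x _ /=; rewrite Normc.normcM normc_conj lee_fin.
set a := normc _; set b := normc _.
have a0 : 0 <= a by exact: normc_ge0.
have b0 : 0 <= b by exact: normc_ge0.
rewrite !ger0_norm ?addr_ge0 ?sqr_ge0 ?mulr_ge0//.
by nra.
Qed.

Lemma L2dotE f g : L2dot f g = cintegral (dotfun f g).
Proof. by []. Qed.

Lemma L2dotDl f g h : L2dot (f + g) h = L2dot f h + L2dot g h.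
Proof.
rewrite !L2dotE -cintegralD; [|exact: dotfun_integrable..].
apply: ae_eq_cintegral; first exact: dotfun_measurable.
  by apply: complex_measurableD; exact: dotfun_measurable.
by apply: filterS (L2reprD f g) => x; rewrite /dotfun => ->; rewrite mulrDl.
Qed.

Lemma L2dotZl (a : R[i]) f h : L2dot (a *: f) h = a * L2dot f h.
Proof.
rewrite !L2dotE -cintegralZ; last exact: dotfun_integrable.
apply: ae_eq_cintegral; first exact: dotfun_measurable.
  apply: (complex_measurableM (complex_measurable_cst X a)).
  exact: dotfun_measurable.
by apply: filterS (L2reprZ a f) => x; rewrite /dotfun => ->; rewrite mulrA.
Qed.

Lemma L2dotC f g : L2dot g f = (L2dot f g)^*.
Proof.
rewrite !L2dotE -cintegral_conj; last exact: dotfun_integrable.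
congr cintegral; apply/funext => x; rewrite /dotfun [RHS]rmorphM [in RHS]mulrC.
by congr (_ * _); exact: (esym (conjCK _)).
Qed.

Lemma L2dotDr f g h : L2dot h (f + g) = L2dot h f + L2dot h g.
Proof. by rewrite (L2dotC (f + g)) L2dotDl rmorphD (L2dotC f) (L2dotC g). Qed.

Lemma L2dotZr (a : R[i]) f h : L2dot h (a *: f) = a^* * L2dot h f.
Proof. by rewrite (L2dotC (a *: f)) L2dotZl rmorphM (L2dotC f). Qed.

Lemma L2dotff f : L2dot f f = (L2norm f ^+ 2)%:C.
Proof.
have zz (z : R[i]) : z * z^* = (normc z ^+ 2)%:C.
  by rewrite sqr_normcE; case: z => a b; congr (_ +i* _) => /=; ring.
rewrite L2dotE /cintegral /dotfun; congr (_ +i* _).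
  apply: EFin_inj; rewrite L2norm_sqr /Rintegral fineK; last first.
    by apply: integrable_fin_num => //; exact/cintegrable_Re/dotfun_integrable.
  by apply: eq_integral => x _; rewrite zz.
rewrite (_ : (fun _ => _) = cst 0) ?Rintegral_cst ?mul0r//.
by apply/funext => x; rewrite zz.
Qed.

Lemma L2dot0l f : L2dot 0 f = 0.
Proof. by rewrite -(scale0r (0 : L2 mu)) L2dotZl mul0r. Qed.

Lemma L2dotBl f g h : L2dot (f - g) h = L2dot f h - L2dot g h.
Proof. by rewrite L2dotDl -scaleN1r L2dotZl mulN1r. Qed.

Lemma L2dot_suml n (c : 'I_n -> L2 mu) h :
  L2dot (\sum_(i < n) c i) h = \sum_(i < n) L2dot (c i) h.
Proof.
elim/big_rec2 : _ => [|i x y _ <-]; first exact: L2dot0l.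
by rewrite L2dotDl.
Qed.

(** Completing the square in [c]: the choice [c = <f, g>] is optimal. This one identity yields
    Bessel's inequality, hence Cauchy-Schwarz, and later the orthogonality of a distance
    minimizer. *)
Lemma L2norm_subZ (c : R[i]) f g : L2norm g = 1 ->
  L2norm (f - c *: g) ^+ 2 = L2norm f ^+ 2 - normc (L2dot f g) ^+ 2
    + normc (c - L2dot f g) ^+ 2.
Proof.
move=> g1; have := L2dotff (f - c *: g).
rewrite L2dotBl -scaleNr !L2dotDr !L2dotZl !L2dotZr !L2dotff g1 (L2dotC f g).
rewrite !sqr_normcE; case: (L2dot f g) => a b; case: c => u v.
by move=> [+ _] /= => <-; ring.
Qed.

Lemma L2_bessel1 f g : L2norm g = 1 -> normc (L2dot f g) <= L2norm f.
Proof.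
move=> g1; rewrite -(ler_pXn2r (n:=2))// ?nnegrE ?L2norm_ge0 ?normc_ge0//.
have := L2norm_subZ (L2dot f g) f g1.
rewrite subrr Normc.normc0 expr0n addr0 -subr_ge0 => <-; exact: sqr_ge0.
Qed.

Lemma L2_normalized f : f != 0 -> L2norm ((L2norm f)^-1%:C *: f) = 1.
Proof.
move=> f0; rewrite L2normZr /Normc.normc/= expr0n/= addr0 sqrtr_sqr.
rewrite ger0_norm ?invr_ge0 ?L2norm_ge0// mulVf//.
by apply: contra_neq f0; exact: L2norm_eq0P.
Qed.

Lemma L2_cauchy_schwarz f g : normc (L2dot f g) <= L2norm f * L2norm g.
Proof.
have [->|g0] := eqVneq g 0.
  by rewrite L2dotC L2dot0l normc_conj Normc.normc0 L2norm0 mulr0.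
have gn0 : 0 < L2norm g.
  rewrite lt_neqAle L2norm_ge0 andbT eq_sym; apply: contra_neq g0; exact: L2norm_eq0P.
have := L2_bessel1 f (L2_normalized g0).
rewrite L2dotZr Normc.normcM normc_conj /Normc.normc/= expr0n/= addr0 sqrtr_sqr.
rewrite ger0_norm ?invr_ge0 ?L2norm_ge0//.
by rewrite ler_pdivrMl// mulrC.
Qed.

End InnerProduct.

(** * Recurrent operators that intertwine level-set projections *)

Section CompactIntertwiners.
Context d1 (X : measurableType d1) d2 (Y : measurableType d2) (R : realType).
Variables (mu : {measure set X -> \bar R}) (nu : {measure set Y -> \bar R}).
Implicit Types (T : L2 mu -> L2 nu) (f : X -> R) (g : Y -> R).

(* A consequence of compactness that can be verified, for norm limits of finite
   rank operators, without knowing that [L2 nu] is complete. *)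
Definition recurrent_on_ball T := forall eta : nat -> L2 mu,
  (forall n, L2norm (eta n) <= 1) -> forall e : R, 0 < e ->
  exists N, forall m, exists2 M, (m <= M)%N & L2norm (T (eta M) - T (eta N)) < e.

Lemma recurrent_on_ball_charmul T (A : set X) (B : set Y) :
  measurable A -> measurable B -> recurrent_on_ball T ->
  recurrent_on_ball (charmul B \o T \o charmul A).
Proof.
move=> mA mB rT eta eta1 e e0.
have [|N NP] := rT (charmul A \o eta) _ e e0.
  by move=> n /=; apply: le_trans (eta1 n); exact: L2norm_charmul_le.
exists N => m; have [M mM MN] := NP m; exists M => //=.
by rewrite -charmulB//; apply: le_lt_trans MN; exact: L2norm_charmul_le.
Qed.

Lemma measurable_sublevel d (Z : measurableType d) (f : Z -> R) (q : R) :
  measurable_fun [set: Z] f -> measurable [set x | f x <= q].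
Proof.
move=> mf; have := mf measurableT [set` `]-oo, q]] (measurable_itv _).
by rewrite setTI; congr measurable; apply/seteqP; split => x /=; rewrite in_itv.
Qed.

Lemma measurable_superlevel d (Z : measurableType d) (f : Z -> R) (q : R) :
  measurable_fun [set: Z] f -> measurable [set x | q <= f x].
Proof.
move=> mf; have := mf measurableT [set` `[q, +oo[] (measurable_itv _).
by rewrite setTI; congr measurable; apply/seteqP; split => x /=; rewrite in_itv/= andbT.
Qed.

Lemma measurable_level d (Z : measurableType d) (f : Z -> R) (q : R) :
  measurable_fun [set: Z] f -> measurable [set x | f x = q].
Proof. by move=> mf; have := mf measurableT [set q] (measurable_set1 q); rewrite setTI. Qed.

(** An index that codes no rational yields 0, itself rational, so exactly the rationals are
    listed. *)
Definition rat_enum (k : nat) : R := if unpickle k is Some r then ratr r else 0.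

Lemma rat_enum_between (a b : R) : a < b -> exists k, a <= rat_enum k < b.
Proof.
move=> ab; have [r] := rat_in_itvoo ab; rewrite in_itv/= => /andP[ar rb].
by exists (pickle r); rewrite /rat_enum pickleK (ltW ar).
Qed.

(* Bisect a vector on which [T] is not small along the levels [f <= q], [q]
   rational; Pythagoras' theorem keeps one of the halves not small.  The images
   of the normalized pieces live on sets shrinking to a level set of [g], which
   contradicts recurrence. *)
Lemma recurrent_intertwiner_eq0 T f g : linear T -> recurrent_on_ball T ->
  measurable_fun [set: X] f -> measurable_fun [set: Y] g ->
  (forall q v, T (charmul [set x | f x <= q] v) = charmul [set y | g y <= q] (T v)) ->
  (forall q v, charmul [set y | g y = q] (T v) = 0) ->
  forall v, T v = 0.
Proof.
move=> lT rT mf mg TAB Tlev v; apply/eqP/negP => /negP Tv0.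
have TZ a u : T (a *: u) = a *: T u.
  have T0 : T 0 = 0.
    by have := lT (-1) 0 0; rewrite !scaleN1r oppr0 addr0 addNr.
  by have := lT a u 0; rewrite T0 !addr0.
have TB u w : T (u - w) = T u - T w by have := lT (-1) w u; rewrite !scaleN1r !(addrC (- _)).
pose A k := [set x | f x <= rat_enum k]; pose B k := [set y | g y <= rat_enum k].
have mA k : measurable (A k) by exact: measurable_sublevel.
have mB k : measurable (B k) by exact: measurable_sublevel.
have v0 : 0 < L2norm v.
  rewrite lt_neqAle L2norm_ge0 andbT eq_sym; apply: contra_neq Tv0 => /L2norm_eq0P ->.
  by rewrite -(scale0r (0 : L2 mu)) TZ scale0r.
have [delta delta0 dv] : exists2 delta, 0 < delta & delta * L2norm v <= L2norm (T v).
  exists (L2norm (T v) / L2norm v); last by rewrite divfK// gt_eqF.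
  apply: mulr_gt0; last by rewrite invr_gt0.
  rewrite lt_neqAle L2norm_ge0 andbT eq_sym.
  by apply: contra_neq Tv0; exact: L2norm_eq0P.
pose good u := 0 < L2norm u /\ delta * L2norm u <= L2norm (T u).
pose side Z (b : bool) (S : set Z) := if b then S else ~` S.
have mside dZ (W : measurableType dZ) b (S : set W) : measurable S -> measurable (side _ b S).
  by case: b => //= mS; exact: measurableC.
have Tside b k u : T (charmul (side _ b (A k)) u) = charmul (side _ b (B k)) (T u).
  case: b; rewrite /= ?TAB//.
  have -> : charmul (~` A k) u = u - charmul (A k) u.
    by rewrite {2}(charmul_setC u (mA k)) addrC addKr.
  by rewrite TB TAB {1}(charmul_setC (T u) (mB k)) addrC addKr.
(* If neither half were good, each image would satisfy the reverse bound, strictly for a nonzero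
   half. One half is nonzero because [u] is, so adding squares contradicts the goodness of [u]. *)
have good_step u k : good u -> exists b, good (charmul (side _ b (A k)) u).
  move=> [u0 uT]; apply: contrapT => /forallNP nb.
  have small b : L2norm (T (charmul (side _ b (A k)) u)) ^+ 2 <=
      delta ^+ 2 * L2norm (charmul (side _ b (A k)) u) ^+ 2 /\
      (L2norm (charmul (side _ b (A k)) u) != 0 ->
       L2norm (T (charmul (side _ b (A k)) u)) ^+ 2 <
      delta ^+ 2 * L2norm (charmul (side _ b (A k)) u) ^+ 2).
    have [/L2norm_eq0P ->|n0] := eqVneq (L2norm (charmul (side _ b (A k)) u)) 0.
      by rewrite L2norm0 -(scale0r (0 : L2 mu)) TZ scale0r L2norm0 !expr0n/= mulr0.
    have : L2norm (T (charmul (side _ b (A k)) u)) ^+ 2 <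
        delta ^+ 2 * L2norm (charmul (side _ b (A k)) u) ^+ 2.
      rewrite -exprMn ltr_pXn2r// ?nnegrE ?mulr_ge0 ?L2norm_ge0 ?ltW//.
      rewrite ltNge; apply/negP => le; apply: (nb b); split => //.
      by rewrite lt_neqAle eq_sym n0 L2norm_ge0.
    by move=> lt; split=> [|_ //]; exact: ltW.
  have : (delta * L2norm u) ^+ 2 <= L2norm (T u) ^+ 2.
    by rewrite ler_pXn2r// nnegrE ?L2norm_ge0// mulr_ge0 ?L2norm_ge0 ?ltW.
  rewrite exprMn (charmul_pythagoras u (mA k)) (charmul_pythagoras (T u) (mB k)) mulrDr.
  have [l1 s1] := small true; have [l2 s2] := small false.
  rewrite -!(Tside true) -!(Tside false) /= in l1 s1 l2 s2 *.
  have u2 : 0 < L2norm u ^+ 2 by rewrite exprn_gt0.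
  rewrite (charmul_pythagoras u (mA k)) in u2.
  have [n1|n1] := eqVneq (L2norm (charmul (A k) u)) 0; last first.
    by have := s1 n1; lra.
  have [n2|n2] := eqVneq (L2norm (charmul (~` A k) u)) 0; last first.
    by have := s2 n2; lra.
  by move: u2; rewrite n1 n2 expr0n addr0 ltxx.
(* The half over [A k] is kept when it is good; otherwise [good_step] makes the other half good.
   [BB n] records the matching choices on the side of [Y]. *)
pose beta k u := `[< good (charmul (A k) u) >].
pose fix V n := if n is k.+1 then charmul (side _ (beta k (V k)) (A k)) (V k) else v.
have VS k : V k.+1 = charmul (side _ (beta k (V k)) (A k)) (V k) by [].
pose BB n := \bigcap_(k < n) side _ (beta k (V k)) (B k).
have mBB n : measurable (BB n) by apply: bigcap_measurableType => k _; exact: mside.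
have BBS k : BB k.+1 = side _ (beta k (V k)) (B k) `&` BB k.
  apply/seteqP; split => [y By|y [yk By] i /=].
    by split=> [|i ik]; [exact: (By k (ltnSn k))|exact: (By i (ltnW ik))].
  by rewrite ltnS leq_eqVlt => /predU1P[-> //|ik]; exact: (By i ik).
have goodV n : good (V n).
  elim: n => [//|n IHn].
  rewrite VS /beta; case: asboolP => // ng.
  by have [[|]] := good_step _ n IHn.
have TV n : T (V n) = charmul (BB n) (T v).
  elim: n => [|n IHn].
    by rewrite (_ : BB 0%N = setT) ?charmulT// /BB II0 bigcap_set0.
  by rewrite VS Tside IHn charmulI ?BBS//; exact: mside.
pose eta n := (L2norm (V n))^-1%:C *: V n.
have etaP n : L2norm (eta n) = 1.
  apply: L2_normalized; have [Vn0 _] := goodV n.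
  by apply: contraTneq Vn0 => ->; rewrite L2norm0 ltxx.
have BBeta n : charmul (BB n) (T (eta n)) = T (eta n).
  by rewrite /eta TZ charmulZ// TV charmulI// setIid.
have Teta n : delta <= L2norm (T (eta n)).
  have [Vn0 Vn] := goodV n.
  rewrite /eta TZ L2normZr /Normc.normc/= expr0n/= addr0 sqrtr_sqr.
  by rewrite ger0_norm ?invr_ge0 ?L2norm_ge0// ler_pdivlMl// mulrC.
have delta2 : 0 < delta / 2 by rewrite divr_gt0.
have [|N NP] := rT eta _ (delta / 2) delta2.
  by move=> n; rewrite etaP.
have mBI : measurable (\bigcap_n BB n) by exact: bigcap_measurable.
(* Two points of the intersection with different values of [g] would be separated by some rational
   level, yet both lie on the side chosen there. So the intersection lies in one level set of [g],
   where images of [T] vanish. *)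
have BI0 : charmul (\bigcap_n BB n) (T (eta N)) = 0.
  have [->|/set0P[y0 By0]] := eqVneq (\bigcap_n BB n) set0; first exact: charmul_set0.
  have sameside k y : (\bigcap_n BB n) y -> side _ (beta k (V k)) (B k) y.
    by move=> By; exact: (By k.+1 I k (ltnSn k)).
  have le_g y z : (\bigcap_n BB n) y -> (\bigcap_n BB n) z -> g y <= g z.
    move=> By Bz; rewrite leNgt; apply/negP => /rat_enum_between[k /andP[k1 k2]].
    have := sameside k _ By; have := sameside k _ Bz.
    case: (beta _ _); rewrite /B /=; first by lra.
    by move=> /negP + /negP; rewrite -!ltNge; lra.
  have -> : \bigcap_n BB n = \bigcap_n BB n `&` [set y | g y = g y0].
    by apply/esym/setIidl => y By /=; apply/eqP; rewrite eq_le !le_g.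
  by rewrite -charmulI ?Tlev ?charmul0//; exact: measurable_level.
have niBB : nonincreasing_seq BB.
  move=> m n mn; apply/subsetPset => y By i im; exact: (By i (leq_trans im mn)).
have [m _ mP] := charmul_nonincreasing_cvg mBB niBB BI0 delta2.
(* At such an [M] the image of [eta M] is carried by [BB M]. It is within [delta / 2] of the image
   of [eta N], whose part over [BB M] is also below [delta / 2]; this contradicts the lower bound
   [delta]. *)
have [M mM MN] := NP m.
have := Teta M; apply/negP; rewrite -ltNge -[T (eta M)]BBeta.
rewrite -[T (eta M)](subrK (T (eta N))) charmulD//.
apply: le_lt_trans (L2norm_triangle _ _) _; rewrite [ltRHS]splitr.
apply: ltrD; last exact: mP.
by apply: le_lt_trans MN; exact: L2norm_charmul_le.
Qed.

End CompactIntertwiners.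

(** * Induction on the number of inequalities, for operators *)

Section FiniteWidth.
Context d1 (X : measurableType d1) d2 (Y : measurableType d2) (R : realType).
Variables (mu : {measure set X -> \bar R}) (nu : {measure set Y -> \bar R}).
Variables (f : nat -> X -> R) (g : nat -> Y -> R).
Hypothesis mf : forall i, measurable_fun [set: X] (f i).
Hypothesis mg : forall i, measurable_fun [set: Y] (g i).

Definition below n (q : nat -> R) : set X := [set x | forall i, (i < n)%N -> f i x <= q i].
Definition above n (q : nat -> R) : set Y := [set y | forall i, (i < n)%N -> q i <= g i y].

(** Only rectangles cut out by thresholds [q] are tested; they lie in the set of the first [n]
    inequalities because [f_i <= q_i <= g_i]. The sets [X0] and [Y0] carry the restrictions
    accumulated during the induction. *)
Definition no_rectangle n (X0 : set X) (Y0 : set Y) := forall q : nat -> R,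
  mu (X0 `&` below n q) = 0%E \/ nu (Y0 `&` above n q) = 0%E.

Lemma measurable_below n q : measurable (below n q).
Proof.
rewrite (_ : below n q = \bigcap_(i < n) [set x | f i x <= q i]).
  by apply: bigcap_measurableType => i _; exact: measurable_sublevel.
by apply/seteqP; split.
Qed.

Lemma measurable_above n q : measurable (above n q).
Proof.
rewrite (_ : above n q = \bigcap_(i < n) [set y | q i <= g i y]).
  by apply: bigcap_measurableType => i _; exact: measurable_superlevel.
by apply/seteqP; split.
Qed.

Lemma no_rectangle0 X0 Y0 : no_rectangle 0 X0 Y0 -> mu X0 = 0%E \/ nu Y0 = 0%E.
Proof.
move=> /(_ (fun=> 0)).
have -> : below 0 (fun=> 0) = setT by apply/seteqP; split.
have -> : above 0 (fun=> 0) = setT by apply/seteqP; split.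
by rewrite !setIT.
Qed.

(** A threshold sequence for the first [n] inequalities becomes one for [n.+1] by taking [c] as its
    entry of index [n]. *)
Lemma no_rectangle_split n X0 Y0 c : no_rectangle n.+1 X0 Y0 ->
  no_rectangle n (X0 `&` [set x | f n x <= c]) (Y0 `&` [set y | c <= g n y]).
Proof.
move=> noR q; pose q' i := if i == n then c else q i; have := noR q'.
rewrite -!setIA (_ : below n.+1 q' = [set x | f n x <= c] `&` below n q); last first.
  apply/seteqP; split => [x xq|x [xc xq] i].
    split=> [|i lin]; first by have := xq n (ltnSn n); rewrite /q' eqxx.
    by have := xq i (ltnW lin); rewrite /q' ltn_eqF.
  by rewrite ltnS leq_eqVlt /q'; case: eqVneq => [-> //|_ /xq].
rewrite (_ : above n.+1 q' = [set y | c <= g n y] `&` above n q)//.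
apply/seteqP; split => [y yq|y [yc yq] i].
  split=> [|i lin]; first by have := yq n (ltnSn n); rewrite /q' eqxx.
  by have := yq i (ltnW lin); rewrite /q' ltn_eqF.
by rewrite ltnS leq_eqVlt /q'; case: eqVneq => [-> //|_ /yq].
Qed.

Lemma recurrent_block_eq0 (T : L2 mu -> L2 nu) : linear T -> recurrent_on_ball T ->
  (forall i q v, charmul [set y | g i y <= q] (T (charmul (~` [set x | f i x <= q]) v)) = 0) ->
  forall n X0 Y0, measurable X0 -> measurable Y0 -> no_rectangle n X0 Y0 ->
  forall v, charmul Y0 (T (charmul X0 v)) = 0.
Proof.
move=> lT rT sT; have TD u w : T (u + w) = T u + T w by have := lT 1 u w; rewrite !scale1r.
have T0 : T 0 = 0 by have := lT (-1) 0 0; rewrite !scaleN1r oppr0 addr0 addNr.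
elim=> [|n IHn] X0 Y0 mX mY noR.
  move=> v; have [X00|Y00] := no_rectangle0 noR; last exact: charmul_null.
  by rewrite (charmul_null _ mX X00) T0 charmul0.
pose T' := charmul Y0 \o T \o charmul X0.
pose A q := [set x | f n x <= q]; pose B q := [set y | g n y <= q].
pose U q := [set y | q <= g n y]; pose L q := [set y | g n y = q].
have mA q : measurable (A q) by exact: measurable_sublevel.
have mAC q : measurable (~` A q) by exact: measurableC.
have mB q : measurable (B q) by exact: measurable_sublevel.
have mBC q : measurable (~` B q) by exact: measurableC.
have mU q : measurable (U q) by exact: measurable_superlevel.
have mL q : measurable (L q) by exact: measurable_level.
(* The corner where [f n <= q <= g n] already satisfies the last inequality, so the induction
   hypothesis applies to it. *)
have Ulow q v : charmul (U q) (T' (charmul (A q) v)) = 0.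
  rewrite /T' /= !charmulI// setIC.
  by apply: (IHn (X0 `&` A q)); [exact: measurableI..|exact: no_rectangle_split].
(* The opposite corner, [f n > q >= g n], is killed by the support hypothesis. *)
have Bhigh q v : charmul (B q) (T' (charmul (~` A q) v)) = 0.
  rewrite /T' /= charmulI// setIC -charmulI// (charmulI _ mX)// setIC -charmulI//.
  by rewrite sT charmul0.
have T'D u w : T' (u + w) = T' u + T' w by rewrite /T' /= charmulD// TD charmulD//.
apply: (@recurrent_intertwiner_eq0 _ _ _ _ _ _ _ T' (f n) (g n)) => //.
- by move=> a u w; rewrite /T' /= charmul_linear// lT charmul_linear.
- exact: recurrent_on_ball_charmul.
(* [T'] sends vectors over [~] A q[off]B q[, and vectors over]A q[off]U q[, which contains]~[B q].
   Hence it intertwines the two projections. *)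
- move=> q v; rewrite -/(A q) -/(B q).
  rewrite [in RHS](charmul_setC v (mA q)) T'D charmulD// Bhigh addr0.
  rewrite [LHS](charmul_setC _ (mB q)).
  suff -> : ~` B q = ~` B q `&` U q by rewrite -charmulI// Ulow charmul0// addr0.
  by apply/esym/setIidl => y /= /negP; rewrite -ltNge => /ltW.
(* The level set lies in both [U q] and [B q], so the parts of [v] over [A q] and over its
   complement both contribute zero. *)
- move=> q v; rewrite -/(L q) [in LHS](charmul_setC v (mA q)) T'D charmulD//.
  rewrite {1}(_ : L q = L q `&` U q); last first.
    by apply/esym/setIidl => y; rewrite /L /U /B /= => ->.
  rewrite -charmulI// Ulow charmul0// add0r (_ : L q = L q `&` B q); last first.
    by apply/esym/setIidl => y; rewrite /L /U /B /= => ->.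
  by rewrite -charmulI// Bhigh charmul0.
Qed.

(** The rectangle [{f_i > q} x {g_i <= q}] misses [E], so support on [E] supplies the vanishing
    blocks needed by [recurrent_block_eq0]. *)
Lemma supports_recurrent_eq0 n (E : set (X * Y)) (T : L2 mu -> L2 nu) :
  linear T -> recurrent_on_ball T ->
  (forall z, E z -> forall i, f i z.1 <= g i z.2) -> supports E T ->
  no_rectangle n [set: X] [set: Y] -> forall v, T v = 0.
Proof.
move=> lT rT Efg sT noR v.
have := recurrent_block_eq0 lT rT _ measurableT measurableT noR v.
rewrite !charmulT; apply => i q w; apply: sT.
- exact/measurableC/measurable_sublevel.
- exact: measurable_sublevel.
- exists set0, set0; split; rewrite ?measure0// => -[x y] [[/= /negP + gy]] /Efg/(_ i) /=.
  by rewrite -ltNge; lra.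
Qed.

End FiniteWidth.

(** * Total boundedness: compact, finite rank and nuclear operators *)

Section TotallyBounded.
Context d1 (X : measurableType d1) d2 (Y : measurableType d2) (R : realType).
Variables (mu : {measure set X -> \bar R}) (nu : {measure set Y -> \bar R}).
Local Notation normc := (@Normc.normc R).
Implicit Types (T S : L2 mu -> L2 nu).

(** The images have a cluster point [z]. Arbitrarily late images come within [e / 2] of [z], hence
    within [e] of one fixed such image. *)
Lemma compact_recurrent T : compact_operator T -> recurrent_on_ball T.
Proof.
rewrite /compact_operator precompactE => cT eta eta1 e e0.
have [|z [_ cz]] := cT (T \o eta @ \oo) (fmap_proper_filter _ _).
  exists 0%N => // n _; apply: subset_closure; exists (eta n) => //=.
  by rewrite L2normE lecR.
have e20 : (0 : R[i]) < (e / 2)%:C by rewrite ltcR divr_gt0.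
have close m : exists2 M, (m <= M)%N & L2norm (z - T (eta M)) < e / 2.
  have [|_ [[M /= mM <-] /ball_L2norm zM]] :=
      cz [set T (eta M) | M in [set M | (m <= M)%N]] _ _ (nbhsx_ballx z _ e20).
    by exists m => // M mM; exists M.
  by exists M.
have [N _ zN] := close 0%N; exists N => m; have [M mM zM] := close m.
exists M => //; rewrite -(subrKA z) [ltRHS]splitr.
apply: le_lt_trans (L2norm_triangle _ _) _; apply: ltrD => //.
by rewrite L2norm_distC.
Qed.

(** Total boundedness of the image of the unit ball, phrased as a finite partition of the domain. In
    this form sums are handled by pairs of colors and uniform limits by reusing the coloring of an
    approximant. *)
Definition finitely_colored T := forall e : R, 0 < e ->
  exists (K : finType) (c : L2 mu -> K), forall u v,
    L2norm u <= 1 -> L2norm v <= 1 -> c u = c v -> L2norm (T u - T v) < e.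

(** Pigeonhole: some color occurs at arbitrarily late indices. Otherwise each color [k] is absent
    from [m k] on, and the index [\max_k m k] would have no color. *)
Lemma finitely_colored_recurrent T : finitely_colored T -> recurrent_on_ball T.
Proof.
move=> cT eta eta1 e e0; have [K [c cP]] := cT e e0.
suff [k kP] : exists k, forall m, exists2 M, (m <= M)%N & c (eta M) = k.
  have [N _ Nk] := kP 0%N; exists N => m; have [M mM Mk] := kP m.
  by exists M => //; apply: cP => //; rewrite Mk Nk.
apply: contrapT => /forallNP noK.
have {}noK k : exists m, forall M, (m <= M)%N -> c (eta M) <> k.
  apply: contrapT => /forallNP nm; apply: (noK k) => m.
  have /existsNP[M /not_implyP[mM /contrapT cM]] := nm m; by exists M.
have [m mP] := choice noK.
exact: (mP (c (eta (\max_k m k))) (\max_k m k) (leq_bigmax _)).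
Qed.

Lemma finitely_colored_lim T :
  (forall e : R, 0 < e -> exists2 S, finitely_colored S &
    forall u, L2norm u <= 1 -> L2norm (T u - S u) <= e) -> finitely_colored T.
Proof.
(* The error splits as [e / 4 + e / 2 + e / 4]: two approximations of [T] by [S], and one comparison
   of values of [S]. *)
move=> approx e e0; have e40 : 0 < e / 4 by rewrite divr_gt0.
have e20 : 0 < e / 2 by rewrite divr_gt0.
have [S /(_ _ e20) [K [c cP]] ST] := approx _ e40; exists K, c => u v u1 v1 uv.
have -> : T u - T v = (T u - S u) + ((S u - S v) + (S v - T v)).
  by rewrite [X in _ = _ + X]addrA subrK addrA subrK.
have := L2norm_triangle (T u - S u) ((S u - S v) + (S v - T v)).
have := L2norm_triangle (S u - S v) (S v - T v).
have := ST _ u1; have := ST _ v1; rewrite (L2norm_distC (S v)).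
by have := cP _ _ u1 v1 uv; lra.
Qed.

Lemma finitely_colored0 : finitely_colored (fun=> 0).
Proof.
by move=> e e0; exists unit, (fun=> tt) => u v _ _ _; rewrite subrr L2norm0.
Qed.

Lemma finitely_coloredD S T : finitely_colored S -> finitely_colored T ->
  finitely_colored (fun u => S u + T u).
Proof.
move=> cS cT e e0; have e20 : 0 < e / 2 by rewrite divr_gt0.
have [K [c cP]] := cS _ e20; have [L [d dP]] := cT _ e20.
exists (K * L)%type, (fun u => (c u, d u)) => u v u1 v1 [cuv duv].
rewrite opprD addrACA [ltRHS]splitr; apply: le_lt_trans (L2norm_triangle _ _) _.
by apply: ltrD; [exact: cP|exact: dP].
Qed.

Lemma finitely_colored_sum (I : Type) (s : seq I) (F : I -> L2 mu -> L2 nu) :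
  (forall i, finitely_colored (F i)) -> finitely_colored (fun u => \sum_(i <- s) F i u).
Proof.
move=> cF; elim: s => [|i s IHs].
  by under eq_fun do rewrite big_nil; exact: finitely_colored0.
by under eq_fun do rewrite big_cons; exact: finitely_coloredD.
Qed.

(** The color of [x] is the index of its cell when the interval from [-C] to [C] is cut into cells
    of length [e]. *)
Lemma real_coloring (C e : R) : 0 < e -> exists (K : finType) (c : R -> K),
  forall x y, `|x| <= C -> `|y| <= C -> c x = c y -> `|x - y| < e.
Proof.
move=> e0; pose t x := Num.truncn ((x + C) / e); pose N := Num.truncn ((C + C) / e).
exists 'I_N.+1, (fun x => inord (t x)).
have tN x : `|x| <= C -> (t x < N.+1)%N.
  move=> xC; rewrite ltnS; apply: le_truncn; rewrite ler_pM2r ?invr_gt0// lerD2r.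
  exact: le_trans (ler_norm _) xC.
have tx x : `|x| <= C -> (t x)%:R * e <= x + C < ((t x)%:R + 1) * e.
  move=> /ler_normlP[xC1 xC2]; have := @truncn_itv _ ((x + C) / e).
  rewrite -ler_pdivlMr// -ltr_pdivrMr// natr1; apply.
  by rewrite divr_ge0 ?(ltW e0)//; lra.
move=> x y xC yC /(congr1 (@nat_of_ord _)); rewrite !inordK ?tN// => txy.
have := tx x xC; have := tx y yC; rewrite txy mulrDl mul1r.
move: ((t y)%:R * e) => k /andP[y1 y2] /andP[x1 x2].
by apply/ltr_normlP; split; lra.
Qed.

(** The real and imaginary parts of the bounded coefficient [phi u] are colored separately. Using
    [L2norm w + 1] in the cell length avoids a division by zero. *)
Lemma rank_one_finitely_colored (phi : L2 mu -> R[i]) (w : L2 nu) (C : R) :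
  (forall u, L2norm u <= 1 -> normc (phi u) <= C) ->
  finitely_colored (fun u => phi u *: w).
Proof.
move=> phiC e e0.
have w0 : 0 < L2norm w + 1 by rewrite ltr_wpDl ?L2norm_ge0.
have e20 : 0 < e / (2 * (L2norm w + 1)) by rewrite divr_gt0// mulr_gt0.
have [K [c cP]] := real_coloring C e20.
exists (K * K)%type, (fun u => (c (complex.Re (phi u)), c (complex.Im (phi u)))).
move=> u v u1 v1 [cr ci]; rewrite -scalerBl L2normZr.
have rP := cP _ _ (le_trans (normr_Re_le_normc _) (phiC u u1))
  (le_trans (normr_Re_le_normc _) (phiC v v1)) cr.
have iP := cP _ _ (le_trans (normr_Im_le_normc _) (phiC u u1))
  (le_trans (normr_Im_le_normc _) (phiC v v1)) ci.
apply: (@le_lt_trans _ _ (normc (phi u - phi v) * (L2norm w + 1))).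
  by rewrite ler_wpM2l ?normc_ge0// lerDl.
rewrite -ltr_pdivlMr//.
have -> : e / (L2norm w + 1) = e / (2 * (L2norm w + 1)) + e / (2 * (L2norm w + 1)).
  by field; rewrite gt_eqF.
apply: le_lt_trans (ltrD rP iP); case: (phi u) (phi v) => [a b] [a' b'] /=.
rewrite -(ler_pXn2r (n:=2))// ?nnegrE ?addr_ge0// ?sqrtr_ge0//.
rewrite sqr_sqrtr ?addr_ge0 ?sqr_ge0// [leRHS]sqrrD !real_normK ?num_real//.
by rewrite addrAC lerDl mulrn_wge0// mulr_ge0.
Qed.

Lemma L2dot_rank_one_colored (u : L2 mu) (w : L2 nu) :
  finitely_colored (fun f => L2dot f u *: w).
Proof.
apply: (@rank_one_finitely_colored _ _ (L2norm u)) => f f1.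
by apply: le_trans (L2_cauchy_schwarz _ _) _; rewrite ler_piMl ?L2norm_ge0.
Qed.

Lemma L2cvgP (F : nat -> L2 nu) (l : L2 nu) :
  (F @ \oo --> l) <-> forall e : R, 0 < e -> \forall n \near \oo, L2norm (l - F n) < e.
Proof.
split=> [/cvgrPdist_lt Fl e e0|Fl].
  have e0' : (0 : R[i]) < e%:C by rewrite ltcR.
  by apply: filterS (Fl _ e0') => n; rewrite L2normE ltcR.
apply/cvgrPdist_lt => e e0.
have eE : e = (complex.Re e)%:C.
  by move: e0; case: e => a b; rewrite ltcE /= => /andP[/eqP -> _].
rewrite eE in e0 *; rewrite ltcR in e0.
by apply: filterS (Fl _ e0) => n; rewrite L2normE ltcR.
Qed.

Lemma nneseries_tail_small (a : nat -> R) : (forall n, 0 <= a n) ->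
  (\sum_(0 <= n <oo) (a n)%:E < +oo)%E -> forall e, 0 < e ->
  exists n, forall m, \sum_(n <= k < m) a k < e.
Proof.
move=> a0 alty e e0.
have a0E n : (0 <= n)%N -> true -> (0 <= (a n)%:E)%E by rewrite lee_fin.
have := is_cvg_nneseries a0E; set L := limn _ in alty * => cvgL.
have L0 : (0 <= L)%E by apply: nneseries_ge0 => n; exact: a0E.
have Lfin : L \is a fin_num by rewrite ge0_fin_numE.
move: (cvgL); rewrite -/L -(fineK Lfin) => /fine_cvgP[_ /cvgrPdist_lt/(_ _ e0)].
move=> [n _ nP]; exists n => m; have [mn|/ltnW nm] := leqP m n; first by rewrite big_geq.
have := nP n (leqnn n) => /=; rewrite sumEFin/= => /ltr_normlP[_]; apply: le_lt_trans.
rewrite lerBrDl -big_cat_nat//= -lee_fin fineK// -sumEFin.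
by apply: nneseries_lim_ge => k; exact: a0E.
Qed.

(** A partial sum of length [n] is of finite rank, and the tail of the sum of [|u_k| |v_k|] bounds
    its distance to longer partial sums uniformly on the unit ball. The longer length [m] may depend
    on [f], but [n] does not. *)
Lemma nuclear_finitely_colored T : nuclear T -> finitely_colored T.
Proof.
move=> [u [v [uvlty Tuv]]]; apply: finitely_colored_lim => e e0.
have e20 : 0 < e / 2 by rewrite divr_gt0.
have uv0 n : 0 <= L2norm (u n) * L2norm (v n) by rewrite mulr_ge0 ?L2norm_ge0.
have [n nP] := nneseries_tail_small uv0 uvlty e20.
exists (fun f => \sum_(i <- index_iota 0 n) L2dot f (u i) *: v i).
  by apply: finitely_colored_sum => i; exact: L2dot_rank_one_colored.
move=> f f1; have /L2cvgP/(_ _ e20)[m0 _ mP] := Tuv f.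
pose m := maxn n m0; have := mP m (leq_maxr _ _); rewrite /series /= => Tm.
rewrite -(subrKA (\sum_(0 <= k < m) L2dot f (u k) *: v k)).
apply: le_trans (L2norm_triangle _ _) _; rewrite [leRHS]splitr; apply: lerD; first exact: ltW.
rewrite (@big_cat_nat _ _ _ n)//= ?leq_maxl// addrAC subrr add0r.
apply: le_trans (ltW (nP m)).
elim/big_rec2 : _ => [|k x y _ xy]; first by rewrite L2norm0.
apply: le_trans (L2norm_triangle _ _) _; apply: lerD => //.
rewrite L2normZr ler_wpM2r ?L2norm_ge0//; apply: le_trans (L2_cauchy_schwarz _ _) _.
by rewrite ler_piMl ?L2norm_ge0.
Qed.

End TotallyBounded.

(** * Finite Fourier sums and Bessel's inequality *)

Section Bessel.
Context d (X : measurableType d) (R : realType).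
Variable mu : {measure set X -> \bar R}.
Local Notation normc := (@Normc.normc R).
Implicit Types (B : set (L2 mu)) (f g : L2 mu).

Definition orthonormal_set B := forall e f, B e -> B f -> L2dot e f = (e == f)%:R.

Definition fourier_sum (s : seq (L2 mu)) g := \sum_(x <- s) L2dot g x *: x.

Lemma orthonormal_norm1 B x : orthonormal_set B -> B x -> L2norm x = 1.
Proof.
move=> oB Bx; have := oB _ _ Bx Bx; rewrite eqxx L2dotff => -[].
by move/eqP; rewrite -[X in _ == X](expr1n _ 2) eqrXn2 ?L2norm_ge0// => /eqP.
Qed.

Lemma L2dot_fourier_sum B s g x : orthonormal_set B -> {subset s <= B} -> B x ->
  x \notin s -> L2dot (fourier_sum s g) x = 0.
Proof.
move=> oB; elim: s => [|y s IHs] sB Bx xs; first by rewrite /fourier_sum big_nil L2dot0l.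
move: xs; rewrite inE negb_or => /andP[xy xs].
have By : B y by exact/set_mem/sB/mem_head.
rewrite /fourier_sum big_cons L2dotDl L2dotZl (oB y x)//.
rewrite eq_sym (negbTE xy) mulr0 add0r; apply: IHs => // z zs.
by apply: sB; rewrite inE zs orbT.
Qed.

(** Induction on [s]: the new vector [x] is orthogonal to the earlier Fourier sum, so its
    coefficient against the remainder is still [<g, x>] and [L2norm_subZ] subtracts the square of
    its modulus. *)
Lemma bessel_eq B s g : orthonormal_set B -> {subset s <= B} -> uniq s ->
  L2norm (g - fourier_sum s g) ^+ 2 = L2norm g ^+ 2 - \sum_(x <- s) normc (L2dot g x) ^+ 2.
Proof.
move=> oB; elim: s => [|x s IHs] sB; first by rewrite /fourier_sum !big_nil !subr0.
move=> /= /andP[xs us]; have Bx : B x by exact/set_mem/sB/mem_head.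
have {}sB : {subset s <= B} by move=> z zs; apply: sB; rewrite inE zs orbT.
have -> : g - fourier_sum (x :: s) g = (g - fourier_sum s g) - L2dot g x *: x.
  by rewrite /fourier_sum big_cons opprD addrCA addrC.
rewrite L2norm_subZ; last exact: orthonormal_norm1 Bx.
have -> : L2dot (g - fourier_sum s g) x = L2dot g x.
  by rewrite L2dotBl (L2dot_fourier_sum _ oB)// subr0.
by rewrite subrr Normc.normc0 expr0n addr0 IHs// big_cons opprD addrA [RHS]addrAC.
Qed.

Lemma bessel_le B s g : orthonormal_set B -> {subset s <= B} -> uniq s ->
  \sum_(x <- s) normc (L2dot g x) ^+ 2 <= L2norm g ^+ 2.
Proof. by move=> oB sB us; rewrite -subr_ge0 -(bessel_eq g oB sB us) sqr_ge0. Qed.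

Lemma fourier_sum_span B s n (c : 'I_n -> R[i]) (e : 'I_n -> L2 mu) :
  orthonormal_set B -> {subset s <= B} -> uniq s -> (forall i, e i \in s) ->
  fourier_sum s (\sum_(i < n) c i *: e i) = \sum_(i < n) c i *: e i.
Proof.
move=> oB sB us es; rewrite /fourier_sum.
under eq_bigr => x _ do rewrite L2dot_suml scaler_suml.
rewrite exchange_big/=; apply: eq_bigr => i _.
under eq_bigr => x _ do rewrite L2dotZl -scalerA.
rewrite -scaler_sumr; congr (_ *: _).
rewrite (bigD1_seq (e i))//= big_seq_cond big1 ?addr0.
  by rewrite oB ?eqxx ?scale1r//; exact/set_mem/sB.
move=> x /andP[xs xi]; rewrite oB; try exact/set_mem/sB.
by rewrite eq_sym (negbTE xi) scale0r.
Qed.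

End Bessel.

(** * Hilbert-Schmidt operators as limits of finite rank operators *)

Section HilbertSchmidt.
Context d1 (X : measurableType d1) d2 (Y : measurableType d2) (R : realType).
Variables (mu : {measure set X -> \bar R}) (nu : {measure set Y -> \bar R}).
Local Notation normc := (@Normc.normc R).

Lemma bounded_operator_L2norm (T : L2 mu -> L2 nu) : bounded_operator T ->
  exists2 M : R, 0 < M & forall f, L2norm (T f) <= M * L2norm f.
Proof.
move=> [C TC]; exists (`|complex.Re C| + 1) => [|f]; first by rewrite ltr_wpDl.
have := TC f; rewrite !L2normE lecE => /andP[_ /=]; case: C {TC} => a b /=.
rewrite mulr0 subr0 => /le_trans; apply; rewrite ler_wpM2r ?L2norm_ge0//.
by apply: le_trans (ler_norm _) _; rewrite lerDl.
Qed.

Lemma sum_le_esum (U : choiceType) (B : set U) (a : U -> R) (s : seq U) :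
  uniq s -> {subset s <= B} -> ((\sum_(x <- s) a x)%:E <= \esum_(x in B) (a x)%:E)%E.
Proof.
move=> us sB; apply: ereal_sup_ubound; exists [set` s].
  by split=> // x /= /sB /set_mem.
by rewrite -sumEFin [RHS]fsbig_seq.
Qed.

(** A finite [s] is chosen whose sum exceeds the total minus [e]. Adjoining a disjoint [t] cannot
    push the sum above the total, so [t] contributes less than [e]. *)
Lemma esum_tail_small (U : choiceType) (B : set U) (a : U -> R) :
  (forall x, 0 <= a x) -> (\esum_(x in B) (a x)%:E < +oo)%E ->
  forall e, 0 < e -> exists s : seq U, [/\ uniq s, {subset s <= B} &
    forall t, uniq (s ++ t) -> {subset t <= B} -> \sum_(x <- t) a x < e].
Proof.
move=> a0 alty e e0; set L := esum _ _ in alty.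
have L0 : (0 <= L)%E by apply: esum_ge0 => x _; rewrite lee_fin.
have Lfin : L \is a fin_num by rewrite ge0_fin_numE.
have [_ [F [/finite_seqP[s0 Fs0] FB] <-]] :
    exists2 y, [set \sum_(x \in A) (a x)%:E | A in fsets B]%E y & (L - e%:E < y)%E.
  exact: ub_ereal_sup_adherent.
rewrite Fs0 => LF; exists (undup s0).
have sB : {subset undup s0 <= B}.
  by move=> x; rewrite mem_undup => xs; apply/mem_set/FB; rewrite Fs0.
split=> [||t ust tB]; [exact: undup_uniq|exact: sB|].
have stB : {subset undup s0 ++ t <= B}.
  by move=> x; rewrite mem_cat => /orP[/sB|/tB].
have := sum_le_esum a ust stB; rewrite -/L big_cat/= => stL.
have sE : [set` s0] = [set` undup s0].
  by apply/seteqP; split => x /=; rewrite mem_undup.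
move: LF; rewrite sE -fsbig_seq ?undup_uniq// sumEFin.
move: stL; rewrite -(fineK Lfin) lee_fin -EFinB lte_fin; lra.
Qed.

(* By AM-GM, [|<g, x>| |T x| <= (r |<g, x>|^2 + |T x|^2 / r) / 2]; the first
   terms are summed by Bessel's inequality, the second by the Hilbert-Schmidt
   norm of the tail. *)
Lemma fourier_tail_le (T : L2 mu -> L2 nu) B t g (r : R) : 0 < r ->
  orthonormal_set B -> {subset t <= B} -> uniq t -> L2norm g <= 2 ->
  \sum_(x <- t) L2norm (T x) ^+ 2 < r ^+ 2 ->
  L2norm (\sum_(x <- t) L2dot g x *: T x) <= 3 * r.
Proof.
move=> r0 oB tB ut g2 Tt.
(* The two AM-GM terms contribute at most [(4 r + r) / 2]; the last [r / 2] is slack. *)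
have -> : 3 * r = (r * 2 ^+ 2 + r ^+ 2 / r) / 2 + r / 2 by field; rewrite gt_eqF.
have bg : \sum_(x <- t) normc (L2dot g x) ^+ 2 <= 2 ^+ 2.
  apply: le_trans (bessel_le g oB tB ut) _.
  by rewrite ler_pXn2r ?nnegrE ?L2norm_ge0.
have le1 : L2norm (\sum_(x <- t) L2dot g x *: T x) <=
    \sum_(x <- t) (r * normc (L2dot g x) ^+ 2 + L2norm (T x) ^+ 2 / r) / 2.
  elim/big_rec2 : _ => [|x y z _ zy]; first by rewrite L2norm0.
  apply: le_trans (L2norm_triangle _ _) _; apply: lerD => //.
  rewrite L2normZr; set a := normc _; set b := L2norm _.
  rewrite -subr_ge0.
  have -> : (r * a ^+ 2 + b ^+ 2 / r) / 2 - a * b = (r * a - b) ^+ 2 / (2 * r).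
    by field; rewrite gt_eqF.
  by rewrite divr_ge0 ?sqr_ge0// mulr_ge0 ?ltW.
apply: le_trans le1 _; rewrite -mulr_suml big_split/= -mulr_sumr -mulr_suml.
rewrite -[leLHS]addr0; apply: lerD; last by rewrite divr_ge0// ltW.
rewrite ler_pM2r ?invr_gt0//; apply: lerD; first by rewrite ler_pM2l.
by rewrite ler_pM2r ?invr_gt0// ltW.
Qed.

Lemma fourier_sum_linear (T : L2 mu -> L2 nu) s g : linear T ->
  T (fourier_sum s g) = \sum_(x <- s) L2dot g x *: T x.
Proof.
move=> lT; have T0 : T 0 = 0 by have := lT (-1) 0 0; rewrite !scaleN1r oppr0 addr0 addNr.
by rewrite /fourier_sum; elim/big_rec2 : _ => [//|i x y _ <-]; rewrite lT.
Qed.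

(** The approximant [S] is [T] after projection onto the span of finitely many basis vectors [s].
    The error is estimated first on the dense span of the basis, then transferred to all of the unit
    ball by boundedness of [T] and [S]. *)
Lemma Hilbert_Schmidt_finitely_colored (T : L2 mu -> L2 nu) : linear T ->
  bounded_operator T -> Hilbert_Schmidt T -> finitely_colored T.
Proof.
have arith (x y z w p q M C e : R) : x * (M + C + 1) <= e / 2 -> w <= 3 * (e / 6) ->
    y <= M * x -> z <= x * C -> 0 <= x -> p <= y + w -> q <= p + z -> q <= e.
  by lra.
move=> lT /bounded_operator_L2norm[M M0 TM] [B [oB spanB] HS].
have TB u w : T (u - w) = T u - T w by have := lT (-1) w u; rewrite !scaleN1r !(addrC (- _)).
apply: finitely_colored_lim => e e0.
pose r := e / 6; have r0 : 0 < r by rewrite divr_gt0.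
have Te0 x : 0 <= L2norm (T x) ^+ 2 by exact: sqr_ge0.
have [s [us sB sP]] := esum_tail_small Te0 HS (exprn_gt0 2 r0).
pose S (f : L2 mu) := \sum_(x <- s) L2dot f x *: T x.
exists S; first by apply: finitely_colored_sum => x; exact: L2dot_rank_one_colored.
move=> f f1; pose C := \sum_(x <- s) L2norm (T x).
have C0 : 0 <= C by apply: sumr_ge0 => x _; exact: L2norm_ge0.
have SC h : L2norm (S h) <= L2norm h * C.
  rewrite /S /C mulr_sumr big_seq [leRHS]big_seq.
  elim/big_rec2 : _ => [|x y z xs zy]; first by rewrite L2norm0.
  apply: le_trans (L2norm_triangle _ _) _; apply: lerD => //.
  rewrite L2normZr ler_wpM2r ?L2norm_ge0//.
  exact/L2_bessel1/(orthonormal_norm1 oB)/set_mem/sB.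
have SB u w : S (u - w) = S u - S w.
  rewrite /S -sumrB; apply: eq_bigr => x _; rewrite -scalerBl; congr (_ *: _).
  exact: L2dotBl.
have MC0 : 0 < M + C + 1 by lra.
(* The bound 1 keeps the approximating [g] within norm 2, as [fourier_tail_le] requires; the other
   bound makes the cost of replacing [f] by [g] at most [e / 2]. *)
pose eps := Num.min 1 (e / 2 / (M + C + 1)).
have eps0 : 0 < eps by rewrite lt_min ltr01 divr_gt0// divr_gt0.
have [g [n [c [x [Bx gE]]]] fg] : exists2 g, lin_span B g & L2norm (f - g) < eps.
  have : closure (lin_span B) f by rewrite spanB.
  by move/closure_L2normP; exact.
have g2 : L2norm g <= 2.
  have -> : g = f - (f - g) by rewrite subKr.
  have := L2norm_triangle f (- (f - g)); rewrite L2normN.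
  have : eps <= 1 by rewrite ge_min lexx.
  by lra.
(* [t] lists the basis vectors occurring in [g] that are not in [s], so that [T g - S g] is exactly
   the tail sum over [t]. *)
pose w := undup (s ++ codom x); pose t := [seq z <- w | z \notin s].
have wB : {subset w <= B}.
  move=> z; rewrite mem_undup mem_cat => /orP[/sB//|/codomP[i ->]]; exact/mem_set.
have tB : {subset t <= B} by move=> z; rewrite mem_filter => /andP[_ /wB].
have ust : uniq (s ++ t).
  rewrite cat_uniq us filter_uniq ?undup_uniq// andbT/=.
  by apply/hasPn => z; rewrite mem_filter => /andP[].
have stB : {subset s ++ t <= B} by move=> z; rewrite mem_cat => /orP[/sB|/tB].
have Tg : T g = S g + \sum_(z <- t) L2dot g z *: T z.
  rewrite -big_cat/= -fourier_sum_linear// gE.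
  rewrite (fourier_sum_span c oB stB ust)// => i.
  by rewrite mem_cat mem_filter mem_undup mem_cat codom_f orbT andbT orbN.
have -> : T f - S f = T (f - g) + (T g - S g) - S (f - g).
  by rewrite TB SB addrA subrK opprB addrA subrK.
have Tgt : L2norm (T g - S g) <= 3 * r.
  rewrite Tg addrAC subrr add0r; apply: (fourier_tail_le r0 oB tB _ g2).
    by move: ust; rewrite cat_uniq => /and3P[].
  exact: (sP t ust tB).
have small : L2norm (f - g) * (M + C + 1) <= e / 2.
  rewrite -ler_pdivlMr//; apply: le_trans (ltW fg) _.
  by rewrite ge_min lexx orbT.
apply: arith small Tgt (TM _) (SC _) _ _ _.
- exact: L2norm_ge0.
- exact: L2norm_triangle.
- by rewrite -(L2normN (S (f - g))); exact: L2norm_triangle.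
Qed.

End HilbertSchmidt.

(** * Completeness of [L2] along fast Cauchy sequences *)

Section Completeness.
Context d (X : measurableType d) (R : realType).
Variable mu : {measure set X -> \bar R}.
Local Notation normc := (@Normc.normc R).

Lemma bounded_variation_cvg (u : nat -> R) (K : R) :
  (forall n, \sum_(0 <= k < n) `|u k.+1 - u k| <= K) -> cvgn u.
Proof.
move=> uK; have : cvgn [normed series (telescope u)].
  rewrite -[[normed series _]]/(fun n => \sum_(0 <= k < n) `|u k.+1 - u k|).
  apply: nondecreasing_is_cvgn.
    by apply/nondecreasing_seqP => n; rewrite big_nat_recr//= lerDl.
  by exists K => _ [n _ <-]; exact: uK.
move=> /normed_cvg ct; rewrite (_ : u = fun n => u 0%N + series (telescope u) n).
  by apply: is_cvgD => //; exact: is_cvg_cst.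
by apply/funext => n; exact: eq_sum_telescope.
Qed.

(** The pointwise increments sum to a square integrable function. Hence the representatives converge
    almost everywhere, and its square [G] dominates the squared errors, so dominated convergence
    gives convergence in norm. *)
Lemma Riesz_Fischer (F : nat -> L2 mu) :
  (forall n, L2norm (F n.+1 - F n) <= 2^-1 ^+ n) ->
  exists l, forall e : R, 0 < e -> \forall n \near \oo, L2norm (l - F n) < e.
Proof.
move=> FF; pose phi n : X -> R[i]^o := L2repr (F n).
(* An element of [L2fun] given by the pointwise difference of the chosen representatives; that of
   [F k.+1 - F k] equals it only almost everywhere. *)
pose diff k : L2fun mu := L2repr (F k.+1) + (-1) *: L2repr (F k).
pose h k x := normc ((phi k.+1 x : R[i]) - phi k x).
have hE k x : h k x = normc (diff k x).
  by rewrite /h; congr normc; rewrite -mulN1r.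
have mphi n : complex_measurable (phi n) by exact: L2repr_measurable.
have mh k : measurable_fun [set: X] (h k).
  rewrite (_ : h k = fun x => normc (diff k x)); last by apply/funext => x; exact: hE.
  by apply: measurable_normc; have [] := L2funP (diff k).
have Nh k : ('N[mu]_2%:E[EFin \o h k] <= (2^-1 ^+ k)%:E)%E.
  rewrite (_ : h k = normc \o diff k); last by apply/funext => x; exact: hE.
  rewrite -L2norm_pi lee_fin; apply: le_trans (FF k).
  rewrite L2pi_add -L2pi_scale !L2reprK (_ : L2scale (-1) (F k) = - F k)//.
  exact: (scaleN1r (F k)).
pose s n x := \sum_(0 <= k < n) h k x.
have ms n : measurable_fun [set: X] (s n) by exact: measurable_sum.
have h0 k x : 0 <= h k x by exact: normc_ge0.
have s0 n x : 0 <= s n x by apply: sumr_ge0 => k _.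
have nds x : nondecreasing_seq (s^~ x).
  by apply/nondecreasing_seqP => n; rewrite /s big_nat_recr//= lerDl.
have Ns n : ('N[mu]_2%:E[EFin \o s n] <= (2 * (1 - 2^-1 ^+ n))%:E)%E.
  elim: n => [|n IHn].
    rewrite (_ : _ \o _ = cst 0%E); last by apply/funext => x; rewrite /= /s big_geq.
    by rewrite Lnorm0 ?eqe ?pnatr_eq0// expr0 subrr mulr0.
  rewrite (_ : s n.+1 = s n \+ h n); last first.
    by apply/funext => x; rewrite /s /= big_nat_recr.
  apply: le_trans (minkowski_EFin mu (ms n) (mh n) (ler1n _ 2)) _.
  apply: le_trans (leeD IHn (Nh n)) _; rewrite -EFinD lee_fin exprS; lra.
have intS n : (\int[mu]_x (s n x ^+ 2)%:E <= 4%:E)%E.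
  have -> : (\int[mu]_x (s n x ^+ 2)%:E = 'N[mu]_2%:E[EFin \o s n] `^ 2)%E.
    rewrite poweR_Lnorm ?pnatr_eq0//; apply: eq_integral => x _ /=.
    by rewrite ger0_norm// powR_mulrn.
  have -> : 4%:E = (2%:E `^ 2 : \bar R)%E.
    by rewrite poweR_EFin powR_mulrn// -natrX.
  apply: gt0_ler_poweR => //; rewrite ?in_itv/= ?leey ?andbT ?Lnorm_ge0//.
  apply: le_trans (Ns n) _; rewrite lee_fin.
  have : 0 <= 2^-1 ^+ n :> R by rewrite exprn_ge0.
  by lra.
pose G x := limn (fun n => (s n x ^+ 2)%:E).
have ndG x : nondecreasing_seq (fun n => (s n x ^+ 2)%:E).
  by move=> m n mn; rewrite lee_fin ler_pXn2r ?nnegrE//; exact: nds.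
have sG n x : ((s n x ^+ 2)%:E <= G x)%E.
  apply: lime_ge; first by apply: ereal_nondecreasing_is_cvgn; exact: ndG.
  by exists n => // m nm; exact: ndG.
have msq n : measurable_fun [set: X] (fun x => (s n x ^+ 2)%:E).
  by apply/measurable_EFinP; exact: measurable_funX.
have cvgG x : (fun n => (s n x ^+ 2)%:E) @ \oo --> G x.
  by apply: ereal_nondecreasing_is_cvgn; exact: ndG.
have mG : measurable_fun [set: X] G by exact: emeasurable_fun_cvg msq (fun x _ => cvgG x).
have G0 x : (0 <= G x)%E.
  by apply: le_trans (sG 0%N x); rewrite lee_fin sqr_ge0.
have iG : mu.-integrable [set: X] G.
  apply/integrableP; split => //; apply: (@le_lt_trans _ _ 4%:E); last exact: ltry.
  under eq_integral => x _ do rewrite gee0_abs//.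
  have sq0 n x : (0 <= (s n x ^+ 2)%:E)%E by rewrite lee_fin sqr_ge0.
  rewrite (monotone_convergence mu measurableT msq (fun n x _ => sq0 n x) (fun x _ => @ndG x)).
  apply: lime_le; last exact: nearW.
  apply: ereal_nondecreasing_is_cvgn => m n mn.
  apply: ge0_le_integral => //.
  by move=> x _; exact: ndG.
(* Outside the null set [N] the total variation of the representatives is finite. *)
have [N [mN N0 NG]] := integrable_ae measurableT iG.
have GN x : ~ N x -> (fine (G x))%:E = G x.
  by move=> Nx; rewrite fineK//; apply: contrapT => Gx; apply: Nx; apply: NG => /(_ I).
have sK n x : ~ N x -> s n x ^+ 2 <= fine (G x).
  by move=> Nx; rewrite -lee_fin GN.
have normK m n x : (n <= m)%N -> ~ N x ->
    normc ((phi m x : R[i]) - phi n x) ^+ 2 <= fine (G x).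
  move=> nm Nx; apply: le_trans (sK m x Nx); rewrite ler_pXn2r ?nnegrE ?normc_ge0//.
  have : normc ((phi m x : R[i]) - phi n x) <= \sum_(n <= k < m) h k x.
    rewrite -(telescope_sumr (fun k => phi k x : R[i]) nm); elim/big_rec2 : _ => [|k y z _ zy].
      by rewrite Normc.normc0.
    by apply: le_trans (le_normcD _ _) _; rewrite lerD2l.
  move=> /le_trans; apply; rewrite /s (@big_cat_nat _ _ _ n 0 m)//= lerDr.
  by apply: sumr_ge0 => k _.
have cvg_part (p : R[i] -> R) : (forall a b, p (a - b) = p a - p b) ->
    (forall z, `|p z| <= normc z) -> forall x, ~ N x -> cvgn (fun n => p (phi n x)).
  (* Only the square of [s n x] is controlled; [a <= 1 + a^2] turns this into a bound on the
     variation. *)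
  move=> pB pn x Nx; apply: (@bounded_variation_cvg _ (1 + fine (G x))) => n.
  apply: (@le_trans _ _ (s n x)).
    by apply: ler_sum => k _; rewrite -pB; exact: pn.
  have := sK n x Nx; have := s0 n x; move: (s n x) (fine _) => a b; nra.
(* Setting the functions to zero on [N] makes the sequence converge everywhere, so its limit is
   measurable. *)
have mlim (p : R[i] -> R) : (forall n, measurable_fun [set: X] (fun x => p (phi n x))) ->
    (forall x, ~ N x -> cvgn (fun n => p (phi n x))) ->
    exists2 q : X -> R, measurable_fun [set: X] q &
      forall x, ~ N x -> (fun n => p (phi n x)) @ \oo --> q x.
  move=> mp cp; pose u n := (fun x => p (phi n x)) \_ (~` N).
  have mu_ n : measurable_fun [set: X] (u n).
    apply/(measurable_restrictT _ (measurableC mN)).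
    by apply: measurable_funS (mp n).
  have cu x : cvgn (u^~ x).
    have [Nx|Nx] := pselect (N x).
      rewrite (_ : u^~ x = fun=> 0); first exact: is_cvg_cst.
      by apply/funext => n; rewrite /u patchE memNset//= => /(_ Nx).
    rewrite (_ : u^~ x = fun n => p (phi n x)); first exact: cp.
    by apply/funext => n; rewrite /u patchE mem_set.
  exists (fun x => limn (u^~ x)) => [|x Nx].
    by apply: (measurable_fun_cvg mu_) => x _; exact: cu.
  rewrite (_ : (fun n => p (phi n x)) = u^~ x); first exact: cu.
  by apply/funext => n; rewrite /u patchE mem_set.
have [lr mlr lrP] := mlim (@complex.Re R) (fun n => (mphi n).1)
  (cvg_part _ (fun a b => raddfB (@complex.Re R) a b) (@normr_Re_le_normc R)).
have [li mli liP] := mlim (@complex.Im R) (fun n => (mphi n).2)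
  (cvg_part _ (fun a b => raddfB (@complex.Im R) a b) (@normr_Im_le_normc R)).
pose e n x : R[i]^o := (lr x - complex.Re (phi n x)) +i* (li x - complex.Im (phi n x)).
have me n : complex_measurable (e n).
  by split; apply: measurable_funB => //; have [] := mphi n.
have ecvg n x : ~ N x ->
    normc ((phi m x : R[i]) - phi n x) ^+ 2 @[m --> \oo] --> normc (e n x) ^+ 2.
  move=> Nx; rewrite sqr_normcE /=.
  under eq_fun do rewrite sqr_normcE !raddfB /=.
  by apply: cvgD; apply: cvgM; apply: cvgB; (exact: lrP || exact: liP || exact: cvg_cst).
have eG n x : ~ N x -> normc (e n x) ^+ 2 <= fine (G x).
  move=> Nx; have /cvg_lim <- // := ecvg n x Nx.
  apply: limr_le; first by apply/cvg_ex; eexists; exact: ecvg.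
  by exists n => // m nm; exact: normK.
have aeN : {ae mu, forall x, ~ N x} by exists N; split => // x /= /contrapT.
have eint n : sq_integrable mu (e n).
  apply: sq_integrableP => //.
  apply: le_lt_trans (_ : \int[mu]_x G x < +oo)%E; last first.
    have /integrableP[_] := iG.
    by under eq_integral => x _ do rewrite gee0_abs//.
  apply: ae_ge0_le_integral => //.
  - by move=> x _; rewrite lee_fin sqr_ge0.
  - by apply/measurable_EFinP; exact: sqr_normc_measurable.
  - by apply: filterS aeN => x Nx _; rewrite -GN// lee_fin eG.
(* The pointwise limit itself is not yet known to be square integrable, but its difference [e 0]
   with the first representative is, being dominated by [G]. *)
pose l := L2class mu (e 0%N) + F 0%N.
have lF n : {ae mu, forall x, L2repr (l - F n) x = e n x}.
  apply: filterS3 (L2reprD l (- F n)) (L2reprD (L2class mu (e 0%N)) (F 0%N))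
    (filterI (L2classE (eint 0%N)) (L2reprZ (-1) (F n))) => x -> -> [-> ].
  rewrite scaleN1r => ->; rewrite mulN1r /e /phi.
  by case: (L2repr (F 0%N) x) => a b; case: (L2repr (F n) x) => a' b'; congr (_ +i* _) => /=; ring.
exists l => r r0.
have normE n : ((L2norm (l - F n) ^+ 2)%:E = \int[mu]_x (normc (e n x) ^+ 2)%:E)%E.
  rewrite L2norm_sqr; apply: ge0_ae_eq_integral => //.
  - by apply/measurable_EFinP; exact/sqr_normc_measurable/L2repr_measurable.
  - by apply/measurable_EFinP; exact/sqr_normc_measurable.
  - by move=> x _; rewrite lee_fin sqr_ge0.
  - by move=> x _; rewrite lee_fin sqr_ge0.
  - by apply: filterS (lF n) => x /= -> _.
have cvg0 : {ae mu, forall x, [set: X] x ->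
    (normc (e n x) ^+ 2)%:E @[n --> \oo] --> (cst 0%E : X -> \bar R) x}.
  apply: filterS aeN => x Nx _; apply/fine_cvgP; split; first exact: nearW.
  suff : normc (e n x) ^+ 2 @[n --> \oo] --> (lr x - lr x) ^+ 2 + (li x - li x) ^+ 2.
    by rewrite !subrr expr0n addr0.
  under eq_fun do rewrite sqr_normcE.
  by apply: cvgD; apply: cvgM; apply: cvgB; (exact: lrP || exact: liP || exact: cvg_cst).
have dom : {ae mu, forall x n, [set: X] x -> (`|(normc (e n x) ^+ 2)%:E| <= G x)%E}.
  apply: filterS aeN => x Nx n _; rewrite gee0_abs ?lee_fin ?sqr_ge0// -GN//.
  by rewrite lee_fin eG.
have mE n : measurable_fun [set: X] (fun x => (normc (e n x) ^+ 2)%:E).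
  by apply/measurable_EFinP; exact/sqr_normc_measurable.
have [_ _] := dominated_convergence measurableT mE (measurable_cst _) cvg0 iG dom.
rewrite integral0; under eq_fun do rewrite -normE.
move=> /fine_cvgP[_] /cvgrPdist_lt/(_ (r ^+ 2)) /=.
rewrite exprn_gt0// => /(_ isT); apply: filterS => n.
rewrite sub0r normrN ger0_norm ?sqr_ge0//.
by rewrite ltr_pXn2r// nnegrE ?L2norm_ge0// ltW.
Qed.

End Completeness.

(** * Orthogonal projection and existence of an orthonormal basis *)

Section OrthonormalBasis.
Context d (X : measurableType d) (R : realType).
Variable mu : {measure set X -> \bar R}.
Local Notation normc := (@Normc.normc R).
Implicit Types (B : set (L2 mu)) (f g : L2 mu).

Lemma L2_parallelogram f g :
  L2norm (f + g) ^+ 2 + L2norm (f - g) ^+ 2 = 2 * (L2norm f ^+ 2 + L2norm g ^+ 2).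
Proof.
have CI (x y : R) : x%:C = y%:C -> x = y by move=> [].
apply: CI; rewrite rmorphM !rmorphD /= -!L2dotff.
rewrite -scaleN1r !(L2dotDl, L2dotDr) !(L2dotZl, L2dotZr).
have -> : (-1 : R[i])^* = -1 by rewrite rmorphN rmorph1.
have -> : (1 : R)%:C = 1 by [].
ring.
Qed.

Lemma lin_span_add B f g : lin_span B f -> lin_span B g -> lin_span B (f + g).
Proof.
move=> [n [c [e [Be ->]]]] [m [c' [e' [Be' ->]]]].
exists (n + m)%N,
  (fun i : 'I_(n + m) => match fintype.split i with inl j => c j | inr j => c' j end),
  (fun i : 'I_(n + m) => match fintype.split i with inl j => e j | inr j => e' j end); split.
  by move=> i; case: (fintype.split i).
rewrite big_split_ord; congr (_ + _); apply: eq_bigr => i _.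
  by case: fintype.splitP => j /= ij; [have -> : i = j by exact: val_inj|
    have := ltn_ord i; rewrite ij -ltn_subRL subnn].
case: fintype.splitP => j /= ij; first by have := ltn_ord j; rewrite -ij -ltn_subRL subnn.
by have -> : i = j by apply/val_inj/(@addnI n).
Qed.

Lemma lin_span_scale B (a : R[i]) f : lin_span B f -> lin_span B (a *: f).
Proof.
move=> [n [c [e [Be ->]]]]; exists n, (fun i => a * c i), e; split => //.
by rewrite scaler_sumr; apply: eq_bigr => i _; rewrite scalerA.
Qed.

Lemma lin_span_mem B f : B f -> lin_span B f.
Proof. by move=> Bf; exists 1%N, (fun=> 1), (fun=> f); rewrite big_ord1 scale1r. Qed.

Lemma lin_span0 B : lin_span B 0.
Proof.
exists 0%N, (fun=> 0), (fun=> 0); split; first by case.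
by rewrite big_ord0.
Qed.

(* The difference between [f] and a limit of a minimizing sequence for the
   distance from [f] to the span of [B]. *)
Lemma exists_orthogonal B f : orthonormal_set B -> ~ closure (lin_span B) f ->
  exists2 g, g != 0 & forall e, B e -> L2dot g e = 0.
Proof.
move=> oB nf; pose D := [set L2norm (f - s) ^+ 2 | s in lin_span B].
have D0 : has_inf D.
  split; first by exists (L2norm (f - 0) ^+ 2), 0 => //; exact: lin_span0.
  by exists 0 => _ [s _ <-]; exact: sqr_ge0.
pose dd := inf D.
have ddP s : lin_span B s -> dd <= L2norm (f - s) ^+ 2.
  by move=> Bs; apply: ge_inf; [exact: D0.2|exists s].
(* The precision is chosen so that the parallelogram law at the midpoint of [s n] and [s n.+1]
   bounds the squared increment by [5/8] of [(2^-1 ^+ n) ^+ 2], as [Riesz_Fischer] needs. *)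
have step n : exists s, lin_span B s /\ L2norm (f - s) ^+ 2 < dd + (2^-1 ^+ n) ^+ 2 / 4.
  have e0 : 0 < (2^-1 ^+ n) ^+ 2 / 4 :> R by rewrite divr_gt0// !exprn_gt0.
  by have [_ [s Bs <-] sd] := inf_adherent e0 D0; exists s.
have [s sP] := choice step.
have sS n : L2norm (s n.+1 - s n) <= 2^-1 ^+ n.
  have [Bs sd] := sP n; have [Bs' sd'] := sP n.+1.
  have mid : lin_span B (2^-1 *: (s n + s n.+1)) by exact/lin_span_scale/lin_span_add.
  rewrite -(ler_pXn2r (n:=2))// ?nnegrE ?L2norm_ge0 ?exprn_ge0//.
  have := L2_parallelogram (f - s n) (f - s n.+1).
  have -> : f - s n - (f - s n.+1) = s n.+1 - s n.
    by rewrite opprB addrC addrA subrK.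
  have -> : f - s n + (f - s n.+1) = 2 *: (f - 2^-1 *: (s n + s n.+1)).
    rewrite scalerBr scalerA mulfV ?pnatr_eq0// scale1r.
    by rewrite addrACA -opprD scaler_nat mulr2n.
  have -> : L2norm (2 *: (f - 2^-1 *: (s n + s n.+1))) ^+ 2 =
      4 * L2norm (f - 2^-1 *: (s n + s n.+1)) ^+ 2.
    rewrite L2normZr exprMn; congr (_ * _).
    by rewrite sqr_normcE /=; ring.
  have tE : (2^-1 ^+ n.+1) ^+ 2 = (2^-1 ^+ n) ^+ 2 / 4 :> R.
    by rewrite [2^-1 ^+ _]exprS; field.
  have := ddP _ mid; move: sd'; rewrite tE.
  move: (L2norm _ ^+ 2) (L2norm _ ^+ 2) (L2norm _ ^+ 2) (L2norm _ ^+ 2) sd => a b c e.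
  have : 0 <= (2^-1 ^+ n) ^+ 2 :> R by exact: sqr_ge0.
  move: ((2^-1 ^+ n) ^+ 2) => t; lra.
have [l lP] := Riesz_Fischer sS.
have dd0 : 0 <= dd by apply: lb_le_inf; [exact: D0.1|move=> _ [? _ <-]; exact: sqr_ge0].
(* Translating the limit [l] by a vector [k] of the span gives a limit of span vectors [s n + k],
   still at distance at least the infimum from [f]. *)
have far k : lin_span B k -> Num.sqrt dd <= L2norm (f - l - k).
  move=> Bk; apply/ler_addgt0Pr => r r0; have [n _ /(_ n (leqnn n)) ln] := lP r r0.
  have := ddP _ (lin_span_add (sP n).1 Bk).
  rewrite -(@ler_sqrt _ dd) ?exprn_ge0 ?L2norm_ge0// sqrtr_sqr ger0_norm ?L2norm_ge0//.
  move=> /le_trans; apply.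
  have -> : f - (s n + k) = (f - l - k) + (l - s n).
    by rewrite [RHS]addrAC [f - l + _]addrA subrK opprD addrA.
  by apply: le_trans (L2norm_triangle _ _) _; rewrite lerD2l ltW.
have near_ : L2norm (f - l) <= Num.sqrt dd.
  apply/ler_addgt0Pr => r r0; have r20 : 0 < r / 2 by rewrite divr_gt0.
  have [m _ mP] := lP _ r20.
  have [k] : exists k, (2^-1 ^+ k : R) < r / 2.
    have half1 : `|2^-1 : R| < 1 by rewrite ger0_norm// invf_lt1// ltr1n.
    have /cvgrPdist_lt half0 := cvg_expr half1.
    have [k _ kP] := half0 _ r20; exists k; have := kP k (leqnn k).
    by rewrite /= sub0r normrN ger0_norm ?exprn_ge0.
  move=> kr; pose n := maxn m k.
  have ln := mP n (leq_maxl _ _); have [_ sd] := sP n.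
  have nr : (2^-1 ^+ n : R) < r / 2.
    apply: le_lt_trans kr; rewrite ler_wiXn2l ?invr_ge0 ?leq_maxr//.
    by rewrite invf_le1// ler1n.
  have -> : f - l = (f - s n) + (s n - l) by rewrite addrA subrK.
  apply: le_trans (L2norm_triangle _ _) _; rewrite (L2norm_distC (s n)).
  suff : L2norm (f - s n) <= Num.sqrt dd + r / 2 by move: ln; rewrite /=; lra.
  rewrite -(ler_pXn2r (n:=2))// ?nnegrE ?L2norm_ge0 ?addr_ge0 ?sqrtr_ge0 ?(ltW r20)//.
  apply: le_trans (ltW sd) _; rewrite sqrrD sqr_sqrtr// -addrA lerD2l.
  have t0 : 0 <= (2^-1 ^+ n : R) by rewrite exprn_ge0.
  have : (2^-1 ^+ n) ^+ 2 <= (r / 2) ^+ 2.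
    by rewrite ler_pXn2r ?nnegrE ?ltW.
  have : 0 <= (2^-1 ^+ n : R) ^+ 2 by exact: sqr_ge0.
  have : 0 <= Num.sqrt dd * (r / 2) by rewrite mulr_ge0 ?sqrtr_ge0 ?ltW.
  by rewrite mulr2n; lra.
exists (f - l) => [|e Be].
  apply: contra_notN nf => /eqP fl; apply/closure_L2normP => r r0.
  have [n _ /(_ n (leqnn n)) ln] := lP r r0; exists (s n); first exact: (sP n).1.
  by rewrite -(subrKA l) fl add0r.
(* Subtracting its component along [e] from [f - l] lowers the squared norm by the squared modulus
   of that component; minimality forces it to vanish. *)
have := far _ (lin_span_scale (L2dot (f - l) e) (lin_span_mem Be)).
move=> /(le_trans near_); rewrite -(ler_pXn2r (n:=2))// ?nnegrE ?L2norm_ge0//.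
rewrite L2norm_subZ; last exact: orthonormal_norm1 Be.
rewrite subrr Normc.normc0 expr0n addr0 -subr_ge0 addrAC subrr sub0r oppr_ge0.
by rewrite exprn_even_le0// => /andP[_ /eqP]; exact: Normc.eq0_normc.
Qed.

(** Zorn's lemma for orthonormal sets: two vectors in the union of a chain lie in one member. If the
    span of a maximal set were not dense, a normalized orthogonal vector would enlarge the set. *)
Lemma exists_orthonormal_basis : exists B : set (L2 mu), orthonormal_basis B.
Proof.
have [|B [oB maxB]] := @Zorn_bigcup (L2 mu) (@orthonormal_set _ _ _ mu).
  move=> F Fo tF e f [S FS Se] [S' FS' S'f].
  by have [/(_ _ Se) S'e|/(_ _ S'f) Sf] := tF _ _ FS FS'; [exact: (Fo S')|exact: (Fo S)].
exists B; split=> //; apply/seteqP; split => // f _; apply: contrapT => nf.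
have [g g0 gB] := exists_orthogonal oB nf.
pose e' := (L2norm g)^-1%:C *: g.
have e'1 : L2dot e' e' = 1 by rewrite L2dotff L2_normalized// expr1n.
have e'B e : B e -> L2dot e' e = 0 by move=> Be; rewrite L2dotZl gB// mulr0.
have Be' e : B e -> L2dot e e' = 0 by move=> Be; rewrite L2dotC e'B// rmorph0.
have ne' e : B e -> (e == e') = false.
  by move=> Be; apply/eqP => ee; have := e'B _ Be; rewrite ee e'1 => /eqP; rewrite oner_eq0.
apply: (maxB (B `|` [set e'])).
  split=> [e Be|BB]; first by left.
  by have := BB e' (or_intror erefl) => /ne'; rewrite eqxx.
move=> a b [Ba|->] [Bb|->]; first exact: oB.
- by rewrite Be'// ne'.
- by rewrite e'B// eq_sym ne'.
- by rewrite e'1 eqxx.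
Qed.

End OrthonormalBasis.

(** * Rank one operators belong to every class considered *)

Section RankOne.
Context d1 (X : measurableType d1) d2 (Y : measurableType d2) (R : realType).
Variables (mu : {measure set X -> \bar R}) (nu : {measure set Y -> \bar R}).
Local Notation normc := (@Normc.normc R).

Definition rank_one (u : L2 mu) (w : L2 nu) (f : L2 mu) : L2 nu := L2dot f u *: w.

Variables (u : L2 mu) (w : L2 nu).

Lemma rank_one_linear : linear (rank_one u w).
Proof. by move=> a f g; rewrite /rank_one L2dotDl L2dotZl scalerDl scalerA. Qed.

HB.instance Definition _ := GRing.isLinear.Build R[i] (L2 mu) (L2 nu) *:%R
  (rank_one u w) rank_one_linear.

Lemma rank_one_bounded : bounded_operator (rank_one u w).
Proof.
exists (L2norm u * L2norm w)%:C => f; rewrite !L2normE -rmorphM lecR L2normZr.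
by rewrite mulrC mulrAC [leRHS]mulrC ler_wpM2l ?L2norm_ge0// mulrC L2_cauchy_schwarz.
Qed.

(** The image of the unit ball lies in the image of a compact square of coefficients under the
    continuous map [z] to [z *: w]. *)
Lemma rank_one_compact : compact_operator (rank_one u w).
Proof.
pose C := L2norm u.
pose K := (fun p : R * R => (p.1 +i* p.2) *: w) @`
  ([set` `[- C, C]] `*` [set` `[- C, C]]).
have cK : compact K.
  apply: continuous_compact; last by apply: compact_setX; exact: segment_compact.
  apply: continuous_subspaceT => -[a b]; apply/cvgrPdist_lt => /= e e0.
  have eE : e = (complex.Re e)%:C.
    by move: e0; case: (e) => x y; rewrite ltcE /= => /andP[/eqP -> _].
  rewrite eE in e0 *; rewrite ltcR in e0.
  pose r := complex.Re e / (2 * (L2norm w + 1)).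
  have w0 : 0 < L2norm w + 1 by rewrite ltr_wpDl ?L2norm_ge0.
  have r0 : 0 < r by rewrite divr_gt0// mulr_gt0.
  exists (ball a r, ball b r); first by split; exact: nbhsx_ballx.
  move=> [a' b'] [/= aa bb]; rewrite -scalerBl L2normE ltcR L2normZr.
  have zr : normc ((a +i* b) - (a' +i* b')) < r + r.
    move: aa bb; rewrite -!ball_normE /= => aa bb.
    apply: le_lt_trans (ltrD aa bb).
    rewrite -(ler_pXn2r (n:=2))// ?nnegrE ?addr_ge0// ?sqrtr_ge0//.
    rewrite sqr_sqrtr ?addr_ge0 ?sqr_ge0// [leRHS]sqrrD !real_normK ?num_real//.
    by rewrite addrAC lerDl mulrn_wge0// mulr_ge0.
  have -> : complex.Re e = (r + r) * (L2norm w + 1) by rewrite /r; field; rewrite gt_eqF.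
  apply: (@le_lt_trans _ _ (normc ((a +i* b) - (a' +i* b')) * (L2norm w + 1))).
    by rewrite ler_wpM2l ?normc_ge0// lerDl.
  by rewrite ltr_pM2r.
rewrite /compact_operator; apply: (@precompact_subset _ _ K).
  move=> _ [f /= f1 <-]; rewrite L2normE lecR in f1.
  have zC : normc (L2dot f u) <= C.
    by apply: le_trans (L2_cauchy_schwarz _ _) _; rewrite ler_piMl ?L2norm_ge0.
  exists (complex.Re (L2dot f u), complex.Im (L2dot f u)).
    split; rewrite /= in_itv/= -ler_norml.
      exact: le_trans (normr_Re_le_normc _) zC.
    exact: le_trans (normr_Im_le_normc _) zC.
  by rewrite /rank_one; case: (L2dot f u).
rewrite precompact_closed//; apply: compact_closed => //; exact: norm_hausdorff.
Qed.

Lemma rank_one_nuclear : nuclear (rank_one u w).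
Proof.
pose u' n : L2 mu := if n is 0%N then u else 0; pose w' n : L2 nu := if n is 0%N then w else 0.
exists u', w'; split.
  rewrite (@nneseries_split _ _ 0 1)//; last first.
    by move=> k _; rewrite lee_fin mulr_ge0 ?L2norm_ge0.
  rewrite big_nat1 eseries0 ?adde0 ?ltry// => -[//|k] _ _.
  by rewrite /= L2norm0 mul0r.
move=> f; apply: cvg_near_cst; exists 1%N => // -[//|n] _.
rewrite /series /= big_nat_recl//= big1 ?addr0// => k _.
by rewrite scaler0.
Qed.

(** For any orthonormal basis, Bessel's inequality for [u] bounds the sum by [|u|^2 |w|^2]. *)
Lemma rank_one_Hilbert_Schmidt : Hilbert_Schmidt (rank_one u w).
Proof.
have [B [oB spanB]] := exists_orthonormal_basis mu; exists B => //.
apply: (@le_lt_trans _ _ (L2norm u ^+ 2 * L2norm w ^+ 2)%:E); last exact: ltry.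
apply: ge_ereal_sup => _ [_ [/finite_seqP[s ->] sB] <-].
have sE : [set` s] = [set` undup s].
  by apply/seteqP; split => x /=; rewrite mem_undup.
have sB' : {subset undup s <= B} by move=> x; rewrite mem_undup => xs; exact/mem_set/sB.
rewrite sE -fsbig_seq ?undup_uniq// sumEFin lee_fin.
apply: le_trans (_ : \sum_(x <- undup s) normc (L2dot u x) ^+ 2 * L2norm w ^+ 2 <= _).
  apply: ler_sum => x _.
  by rewrite /rank_one L2normZr exprMn (L2dotC u) normc_conj.
by rewrite -mulr_suml ler_wpM2r ?sqr_ge0// (bessel_le u oB sB')// undup_uniq.
Qed.

Lemma rank_one_neq0 : u != 0 -> w != 0 -> rank_one u w u != 0.
Proof.
move=> u0 w0; rewrite /rank_one scaler_eq0 (negbTE w0) orbF L2dotff.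
apply: contra_neq u0 => /(congr1 (@complex.Re R)) /= /eqP.
by rewrite sqrf_eq0 => /eqP; exact: L2norm_eq0P.
Qed.

Lemma L2dot_charmul (A : set X) (f g : L2 mu) : measurable A ->
  L2dot (charmul A f) g = L2dot f (charmul A g).
Proof.
move=> mA; rewrite !L2dotE; apply: ae_eq_cintegral; try exact: dotfun_measurable.
apply: filterS2 (charmulE f mA) (charmulE g mA) => x; rewrite /dotfun => -> ->.
rewrite rmorphM mulrCA mulrA; congr (_ * _ * _).
by rewrite indicE; case: (x \in A) => /=; rewrite ?rmorph1 ?rmorph0.
Qed.

Lemma rank_one_supports (E : set (X * Y)) (alpha : set X) (beta : set Y) :
  measurable alpha -> measurable beta -> alpha `*` beta `<=` E ->
  charmul alpha u = u -> charmul beta w = w -> supports E (rank_one u w).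
Proof.
move=> ma mb abE ua wb a b ma' mb' [X0 [Y0 [mX0 X00 mY0 Y00 null]]] f.
rewrite /rank_one charmulZ//.
(* Either [a] meets [alpha] in a null set, or a point [x] of [a] and [alpha] outside [X0] exists. In
   the second case the slice at [x] forces the common part of [b] and [beta] into [Y0]. *)
have [aX|/existsNP[x /not_implyP[[ax alx] xX0]]] := pselect (a `&` alpha `<=` X0).
  rewrite -ua -L2dot_charmul// charmulI// (charmul_null (A := alpha `&` a)).
  - by rewrite L2dot0l scale0r.
  - exact: measurableI.
  - by rewrite setIC; apply: subset_measure0 aX X00 => //; exact: measurableI.
have bY : b `&` beta `<=` Y0.
  move=> y [by_ bey]; have := null (x, y); case => //=; last by case.
    by split => //; exact: abE.
  by case.
have bb0 : nu (b `&` beta) = 0%E.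
  by apply: subset_measure0 bY Y00 => //; exact: measurableI.
by rewrite -wb charmulI// (charmul_null w (measurableI _ _ mb' mb) bb0) scaler0.
Qed.

End RankOne.

(** * Nonzero vectors of [L2] carried by a given set *)

Section Indicator.
Context d (X : measurableType d) (R : realType).
Local Notation normc := (@Normc.normc R).

Lemma indicator_L2 (mu : {measure set X -> \bar R}) (A : set X) : measurable A ->
  mu A != 0%E -> (mu A < +oo)%E -> exists2 u : L2 mu, u != 0 & charmul A u = u.
Proof.
move=> mA A0 Aoo; pose k (x : X) : R[i]^o := (\1_A x : R)%:C.
have mk : complex_measurable k.
  by split => /=; [exact: measurable_indic|exact: measurable_cst].
have kE x : normc (k x) ^+ 2 = \1_A x.
  rewrite sqr_normcE /= expr0n addr0 indicE; case: (x \in A) => /=.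
    by rewrite expr1n.
  by rewrite expr0n.
have intk : (\int[mu]_x (normc (k x) ^+ 2)%:E = mu A)%E.
  under eq_integral => x _ do rewrite kE.
  by rewrite integral_indic// setIT.
have sk : sq_integrable mu k by apply: sq_integrableP => //; rewrite intk.
exists (L2class mu k).
  apply/eqP => k0; move/eqP: A0; apply; rewrite -intk.
  have : ((L2norm (L2class mu k) ^+ 2)%:E = 0)%E by rewrite k0 L2norm0 expr0n.
  rewrite L2norm_sqr => <-; apply: ge0_ae_eq_integral => //.
  - by apply/measurable_EFinP; exact: sqr_normc_measurable.
  - by apply/measurable_EFinP; exact/sqr_normc_measurable/L2repr_measurable.
  - by move=> x _; rewrite lee_fin sqr_ge0.
  - by move=> x _; rewrite lee_fin sqr_ge0.
  - by apply: filterS (L2classE sk) => x /= ->.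
apply/L2eqP; apply: filterS2 (charmulE (L2class mu k) mA) (L2classE sk) => x -> ->.
rewrite /k -rmorphM indicE; case: (x \in A) => /=; first by rewrite mulr1.
by rewrite mulr0.
Qed.

(** Some piece of a countable cover by sets of finite measure meets [A] in positive measure; the
    indicator of that intersection serves. *)
Lemma sigma_finite_indicator_L2 (mu : {sigma_finite_measure set X -> \bar R}) (A : set X) :
  measurable A -> mu A != 0%E -> exists2 u : L2 mu, u != 0 & charmul A u = u.
Proof.
move=> mA A0; have [F TF mF] := sigma_finiteT mu.
have [n An0] : exists n, mu (A `&` F n) != 0%E.
  apply: contrapT => /forallNP null; move/eqP: A0; apply.
  apply: measure_negligible => //; rewrite -[A]setIT TF setI_bigcupr.
  apply: negligible_bigcup => n; apply/negligibleP.
    by apply: measurableI => //; exact: (mF n).1.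
  by have /negP/negPn/eqP := null n.
have mAn : measurable (A `&` F n) by apply: measurableI => //; exact: (mF n).1.
have Anoo : (mu (A `&` F n) < +oo)%E.
  apply: le_lt_trans (mF n).2; apply: le_measure; rewrite ?inE//; first exact: (mF n).1.
have [u u0 Au] := indicator_L2 mAn An0 Anoo; exists u => //.
by rewrite -Au charmulI// setIA setIid.
Qed.

End Indicator.

(** * Level sets of positive measure are countably many *)

Section Atoms.
Import mathcomp.finmap.finmap.
Context d (Y : measurableType d) (R : realType).
Variable g : Y -> R.
Hypothesis mg : measurable_fun [set: Y] g.

(** Level sets are disjoint, so more than [nu F / e] of them with mass at least [e] in [F] would
    exceed the mass of [F]. *)
Lemma finite_large_levels (nu : {measure set Y -> \bar R}) (F : set Y) (e : R) :
  measurable F -> (nu F < +oo)%E -> 0 < e ->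
  finite_set [set c | (e%:E <= nu ([set y | g y = c] `&` F))%E].
Proof.
move=> mF Foo e0; apply: contrapT => infA.
have Ffin : nu F \is a fin_num by rewrite ge0_fin_numE.
pose N := (Num.truncn (fine (nu F) / e)).+1.
have [B BA NB] := infinite_set_fset N infA.
pose Z c := [set y | g y = c] `&` F.
have mZ c : measurable (Z c) by apply: measurableI => //; exact: measurable_level.
have tZ : trivIset [set` B] Z by move=> c c' _ _ [y [[/= <- _] [/= <- _]]].
have : (nu (\big[setU/set0]_(c <- B) Z c) <= nu F)%E.
  rewrite -bigcup_fset; apply: le_measure; last by apply: bigcup_sub => c _ y [].
    by apply/mem_set/fin_bigcup_measurable => // c _; exact: mZ.
  exact/mem_set.
rewrite measure_fbigsetU// leNgt => /negP; apply.
apply: (@lt_le_trans _ _ (\sum_(c <- B) e%:E)%E); last first.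
  by rewrite !big_seq; apply: lee_sum => c cB; exact: BA.
rewrite sumEFin big_const_seq count_predT iter_addr_0 -(fineK Ffin) lte_fin.
rewrite -mulr_natl -ltr_pdivrMr//; apply: lt_le_trans (truncnS_gt _) _.
by rewrite ler_nat.
Qed.

Lemma countable_levels (nu : {sigma_finite_measure set Y -> \bar R}) :
  countable [set c | nu [set y | g y = c] <> 0%E].
Proof.
have [F TF mF] := sigma_finiteT nu.
pose A m k := [set c | ((k.+1%:R^-1 : R)%:E <= nu ([set y | g y = c] `&` F m))%E].
apply: (@sub_countable _ _ _ (\bigcup_m \bigcup_k A m k)).
  apply: subset_card_le => c /= nc; apply: contrapT => nA; apply: nc.
  apply: measure_negligible; first exact: measurable_level.
  rewrite -[X in _.-negligible X]setIT TF setI_bigcupr; apply: negligible_bigcup => m.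
  have mm : measurable ([set y | g y = c] `&` F m).
    by apply: measurableI; [exact: measurable_level|exact: (mF m).1].
  apply/negligibleP => //; apply/eqP; rewrite -measure_le0; apply/lee_addgt0Pr => e e0.
  rewrite add0e leNgt; apply/negP => ce; apply: nA; exists m => //.
  have [k ke] : exists k, (k.+1%:R^-1 : R) < e.
    exists (Num.truncn e^-1); rewrite invf_plt ?posrE//; exact: truncnS_gt.
  by exists k => //; rewrite /A /= ltW// (le_lt_trans _ ce)// lee_fin ltW.
apply: bigcup_countable => // m _; apply: bigcup_countable => // k _.
apply: finite_set_countable; apply: finite_large_levels; rewrite ?invr_gt0//.
  exact: (mF m).1.
exact: (mF m).2.
Qed.

End Atoms.

(** * Sets of finite width that are null for the product measure *)

Section ProductNull.
Context d1 (X : measurableType d1) d2 (Y : measurableType d2) (R : realType).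
Variables (mu : {sigma_finite_measure set X -> \bar R})
  (nu : {sigma_finite_measure set Y -> \bar R}).

Lemma measurable_le_product (f : X -> R) (g : Y -> R) :
  measurable_fun [set: X] f -> measurable_fun [set: Y] g ->
  measurable_fun [set: X * Y] (fun z => f z.1 - g z.2).
Proof.
move=> mf mg; apply: measurable_funB.
  exact: measurableT_comp mf measurable_fst.
exact: measurableT_comp mg measurable_snd.
Qed.

(** By integration over sections: the section at [x] lies in the level set of [g] at [f x]. It is
    empty if [f x] is an atom, and null otherwise. *)
Lemma nonatomic_graph_null (f : X -> R) (g : Y -> R) (C := [set c | nu [set y | g y = c] <> 0%E]) :
  measurable_fun [set: X] f -> measurable_fun [set: Y] g ->
  (mu \x nu)%E.-negligible [set z | f z.1 = g z.2 /\ ~ C (g z.2)].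
Proof.
move=> mf mg; set D := [set z | _].
have mC : measurable (~` C).
  by apply/measurableC/countable_measurable; [exact: measurable_set1|exact: countable_levels].
have mD : measurable D.
  rewrite (_ : D = [set z | f z.1 - g z.2 = 0] `&` [set: X] `*` (g @^-1` (~` C))).
    apply: measurableI; first exact: (measurable_level 0 (measurable_le_product mf mg)).
    by apply: measurableX => //; have := mg measurableT _ mC; rewrite setTI.
  apply/seteqP; split=> [[x y] [/= fg nC]|[x y] [/= fg [_ nC]]].
    by split; [rewrite /= fg subrr|split].
  by split => //; apply/eqP; rewrite -subr_eq0; exact/eqP.
apply/negligibleP => //=; rewrite /product_measure1.
rewrite -[RHS](integral0 mu setT); apply: eq_integral => x _ /=.
have [Cf|nCf] := pselect (C (f x)).
  rewrite (_ : xsection D x = set0) ?measure0//; apply/seteqP; split => // y.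
  by move=> /set_mem[/= fg]; rewrite -fg.
have /contrapT nf : ~ ~ (nu [set y | g y = f x] = 0%E) by exact: nCf.
apply: subset_measure0 nf; first exact: measurable_xsection.
  exact: measurable_level.
by move=> y /set_mem[/= ->].
Qed.

Variables (f : nat -> X -> R) (g : nat -> Y -> R).
Hypothesis mf : forall i, measurable_fun [set: X] (f i).
Hypothesis mg : forall i, measurable_fun [set: Y] (g i).

Definition width_set n : set (X * Y) := [set z | forall i, (i < n)%N -> f i z.1 <= g i z.2].

Lemma measurable_width_set n : measurable (width_set n).
Proof.
rewrite (_ : width_set n = \bigcap_(i < n) [set z | f i z.1 - g i z.2 <= 0]).
  apply: bigcap_measurableType => i _.
  exact: (measurable_sublevel 0 (measurable_le_product (mf i) (mg i))).
apply/seteqP; split => z zn i /= ln; first by rewrite subr_le0; exact: zn.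
by rewrite -subr_le0; exact: zn.
Qed.

(* Off a null set, a point with [f_n x <= g_n y] lies in a rectangle
   [{f_n <= c} x {c <= g_n}] with [c] rational or an atom of [g_n]. *)
Lemma no_rectangle_null n X0 Y0 : measurable X0 -> measurable Y0 ->
  no_rectangle mu nu f g n X0 Y0 ->
  (mu \x nu)%E.-negligible (width_set n `&` X0 `*` Y0).
Proof.
elim: n X0 Y0 => [|n IHn] X0 Y0 mX mY noR.
  apply: (@negligibleS _ _ _ _ (X0 `*` Y0)); first by move=> z [].
  apply/negligibleP; first exact: measurableX.
  transitivity (mu X0 * nu Y0)%E; first exact: product_measure1E.
  by have [->|->] := no_rectangle0 noR; rewrite ?mul0e ?mule0.
pose S c := width_set n `&` (X0 `&` [set x | f n x <= c]) `*` (Y0 `&` [set y | c <= g n y]).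
have nS c : (mu \x nu)%E.-negligible (S c).
  apply: IHn; last exact: no_rectangle_split.
    by apply: measurableI => //; exact: measurable_sublevel.
  by apply: measurableI => //; exact: measurable_superlevel.
pose C := [set c | nu [set y | g n y = c] <> 0%E].
have [code codeP] := countable_injP _ (countable_levels (mg n) nu).
(* A number coding no atom is sent to 0; this is harmless, since [nS] holds for every level [c]. *)
pose atom k := xget 0 [set c | C c /\ code c = k].
have atomP c : C c -> atom (code c) = c.
  move=> Cc; rewrite /atom; case: xgetP => [c' _ [Cc' cc']|/(_ c) nc]; last by case: nc; split.
  by apply: codeP => //; exact: mem_set.
have nU : (mu \x nu)%E.-negligible ((\bigcup_k S (rat_enum R k)) `|` (\bigcup_k S (atom k))
    `|` [set z | f n z.1 = g n z.2 /\ ~ C (g n z.2)]).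
  apply: negligibleU; last exact: nonatomic_graph_null.
  by apply: negligibleU; apply: negligible_bigcup => k; exact: nS.
apply: negligibleS nU.
move=> [x y] [zn [X0x Y0y]].
have zn' : width_set n (x, y) by move=> i ln; apply: zn; exact: ltnW.
have := zn n (ltnSn n); rewrite /= le_eqVlt => /predU1P[fg|/rat_enum_between[k /andP[fk kg]]].
  have [Cg|nCg] := pselect (C (g n y)); last by right.
  left; right; exists (code (g n y)) => //; rewrite atomP//.
  by split => //; split; split => //=; rewrite fg.
by left; left; exists k => //; split => //; split; split => //=; exact: ltW.
Qed.

End ProductNull.

(** * Rectangles, supported operators and the equivalence *)

Section Equivalence.
Context d1 (X : measurableType d1) d2 (Y : measurableType d2) (R : realType).
Variables (mu : {sigma_finite_measure set X -> \bar R})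
  (nu : {sigma_finite_measure set Y -> \bar R}) (E : set (X * Y)).

Definition contains_rectangle := exists (alpha : set X) (beta : set Y),
  [/\ measurable alpha, measurable beta, alpha `*` beta `<=` E &
      (mu \x nu)%E (alpha `*` beta) <> 0%E].

Lemma contains_rectangle_rank_one : contains_rectangle ->
  exists u w, supports E (rank_one u w : L2 mu -> L2 nu) /\ exists f, rank_one u w f != 0.
Proof.
move=> [alpha [beta [ma mb abE ab0]]].
have abM : (mu \x nu)%E (alpha `*` beta) = (mu alpha * nu beta)%E.
  exact: product_measure1E.
have a0 : mu alpha != 0%E by apply/eqP => a0; apply: ab0; rewrite abM a0 mul0e.
have b0 : nu beta != 0%E by apply/eqP => b0; apply: ab0; rewrite abM b0 mule0.
have [u u0 ua] := sigma_finite_indicator_L2 ma a0.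
have [w w0 wb] := sigma_finite_indicator_L2 mb b0.
exists u, w; split; first exact: rank_one_supports abE ua wb.
by exists u; exact: rank_one_neq0.
Qed.

Lemma contains_rectangle_supports (P : (L2 mu -> L2 nu) -> Prop) :
  (forall u w, P (rank_one u w)) -> contains_rectangle -> supports_nonzero P E.
Proof.
move=> PT /contains_rectangle_rank_one[u [w [sE neq0]]].
exists (rank_one u w).
by split; [exact: rank_one_bounded|exact: sE|exact: PT|exact: neq0].
Qed.

Hypothesis finE : finite_width R E.

(** Padding with zero functions gives sequences indexed by [nat]; the added inequalities read
    [0 <= 0], so points of [E] satisfy all of them. *)
Lemma finite_width_nat : exists n (f : nat -> X -> R) (g : nat -> Y -> R),
  [/\ forall i, measurable_fun [set: X] (f i), forall i, measurable_fun [set: Y] (g i),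
      E = width_set f g n & forall z, E z -> forall i, f i z.1 <= g i z.2].
Proof.
have [n [f [g [mf mg EE]]]] := finE.
exists n, (fun i x => if insub i is Some j then f j x else 0),
  (fun i y => if insub i is Some j then g j y else 0).
have Efg : forall z, E z -> forall i, (if insub i is Some j then f j z.1 else 0) <=
    (if insub i is Some j then g j z.2 else 0).
  by move=> z + i; rewrite EE => /= Ez; case: insub.
split => //.
- by move=> i; case: insub => [j|]; [exact: mf|exact: measurable_cst].
- by move=> i; case: insub => [j|]; [exact: mg|exact: measurable_cst].
apply/seteqP; split => [z Ez i _|z zn]; first exact: Efg.
by rewrite EE => j; have := zn j (ltn_ord j); rewrite valK.
Qed.

Lemma not_contains_rectangle n (f : nat -> X -> R) (g : nat -> Y -> R) :
  (forall i, measurable_fun [set: X] (f i)) -> (forall i, measurable_fun [set: Y] (g i)) ->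
  E = width_set f g n -> ~ contains_rectangle ->
  no_rectangle mu nu f g n [set: X] [set: Y].
Proof.
move=> mf mg EE noR q; rewrite !setTI.
have mb := measurable_below mf n q; have ma := measurable_above mg n q.
have : (mu (below f n q) * nu (above g n q) = 0)%E.
  have <- : (mu \x nu)%E (below f n q `*` above g n q) =
    (mu (below f n q) * nu (above g n q))%E by exact: product_measure1E.
  apply: contrapT => ne0; apply: noR; exists (below f n q), (above g n q); split => //.
  rewrite EE => -[x y] [/= xq yq] i ln; exact: le_trans (xq i ln) (yq i ln).
by move=> /eqP; rewrite mule_eq0 => /orP[|] /eqP; [left|right].
Qed.

Lemma not_contains_rectangle_null : ~ contains_rectangle -> (mu \x nu)%E E = 0%E.
Proof.
have [n [f [g [mf mg EE _]]]] := finite_width_nat => noR.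
have := no_rectangle_null mf mg measurableT measurableT
  (not_contains_rectangle mf mg EE noR).
rewrite setXTT setIT -EE => nE; apply: measure_negligible => //.
by rewrite EE; exact: measurable_width_set.
Qed.

(** Compact, Hilbert-Schmidt and nuclear operators are treated uniformly: the class [P] enters only
    through recurrence. *)
Lemma not_contains_rectangle_supports (P : (L2 mu -> L2 nu) -> Prop) :
  (forall T, linear T -> bounded_operator T -> P T -> recurrent_on_ball T) ->
  ~ contains_rectangle -> ~ supports_nonzero P E.
Proof.
have [n [f [g [mf mg EE Efg]]]] := finite_width_nat.
move=> Prec noR [T [bT sT PT [u /eqP]]]; apply.
have lT : linear T by move=> a v w; rewrite linearP.
apply: (supports_recurrent_eq0 mf mg lT _ Efg sT (not_contains_rectangle mf mg EE noR)).
exact: Prec.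
Qed.

End Equivalence.

Theorem corollary5p5 (R : realType)
    (d1 : measure_display) (X : measurableType d1)
    (d2 : measure_display) (Y : measurableType d2)
    (mu : {sigma_finite_measure set X -> \bar R})
    (nu : {sigma_finite_measure set Y -> \bar R})
    (hmu : standard_measure mu) (hnu : standard_measure nu)
    (E : set (X * Y)) (hE : finite_width R E) :
  [<-> operator_U_set mu nu E;
       ~ supports_nonzero (@Hilbert_Schmidt _ X _ Y R mu nu) E;
       (mu \x nu)%E E = 0%E;
       ~ supports_nonzero (@nuclear _ X _ Y R mu nu) E;
       ~ exists (alpha : set X) (beta : set Y),
           [/\ measurable alpha, measurable beta,
               alpha `*` beta `<=` E &
               (mu \x nu)%E (alpha `*` beta) <> 0%E]].
Proof.
rewrite -/(contains_rectangle mu nu E).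
have noU : ~ contains_rectangle mu nu E -> operator_U_set mu nu E.
  by apply: not_contains_rectangle_supports => // T _ _; exact: compact_recurrent.
have noHS : ~ contains_rectangle mu nu E ->
    ~ supports_nonzero (@Hilbert_Schmidt _ X _ Y R mu nu) E.
  apply: not_contains_rectangle_supports => // T lT bT HST.
  exact/finitely_colored_recurrent/Hilbert_Schmidt_finitely_colored.
have noN : ~ contains_rectangle mu nu E ->
    ~ supports_nonzero (@nuclear _ X _ Y R mu nu) E.
  apply: not_contains_rectangle_supports => // T _ _ NT.
  exact/finitely_colored_recurrent/nuclear_finitely_colored.
(* Each arrow of the cycle passes through the absence of rectangles: a rank one operator on a
   rectangle gives the contrapositive for operator classes, and monotonicity of the measure handles
   a null [E]. *)
tfae.
- move=> U; apply: noHS; apply: contra_not U.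
  by apply: contains_rectangle_supports => u w; exact: rank_one_compact.
- move=> HS; apply: not_contains_rectangle_null => //; apply: contra_not HS.
  by apply: contains_rectangle_supports => u w; exact: rank_one_Hilbert_Schmidt.
- move=> E0; apply: noN => -[alpha [beta [ma mb abE]]]; apply.
  have [n [f [g [mf mg EE _]]]] := finite_width_nat hE.
  apply: subset_measure0 abE E0; first exact: measurableX.
  by rewrite EE; exact: measurable_width_set.
- move=> N; apply: contra_not N.
  by apply: contains_rectangle_supports => u w; exact: rank_one_nuclear.
- exact: noU.
Qed.
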